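(* Let $\Omega$ be an infinite set. Then there are $0,1$-lattice embeddings from $(\operatorname{Eq}\Omega)^{\mathrm{op}}\amalg^1(\operatorname{Eq}\Omega)^{\mathrm{op}}$ into $(\operatorname{Eq}\Omega)^{\mathrm{op}}$ and from $(\operatorname{Eq}\Omega)^{\mathrm{op}}\amalg(\operatorname{Eq}\Omega)^{\mathrm{op}}$ into $(\operatorname{Eq}\Omega)^{\mathrm{op}}$.
   Context: $\operatorname{Eq}\Omega$ denotes the lattice of all equivalence relations on the set $\Omega$, ordered by inclusion. For a lattice $L$, $L^{\mathrm{op}}$ is the dual lattice (same underlying set, reversed order). For lattices with a unit (greatest element) $L_1,L_2$, $L_1\amalg^1L_2$ denotes their coproduct in the category of lattices with unit and unit-preserving lattice homomorphisms; $L_1\amalg L_2$ denotes their coproduct (free product) in the variety of all lattices. A $0,1$-lattice embedding is a one-to-one lattice homomorphism preserving least and greatest elements. *)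

(* Defs.v *)
From Stdlib Require Import List Relation_Definitions.

Set Implicit Arguments.

Definition is_lattice (T : Type) (m j : T -> T -> T) : Prop :=
  (forall x y z, m x (m y z) = m (m x y) z) /\
  (forall x y z, j x (j y z) = j (j x y) z) /\
  (forall x y, m x y = m y x) /\
  (forall x y, j x y = j y x) /\
  (forall x y, m x (j x y) = x) /\
  (forall x y, j x (m x y) = x).

Definition is_top (T : Type) (m : T -> T -> T) (t : T) : Prop :=
  forall x, m x t = x.

Definition is_bot (T : Type) (m : T -> T -> T) (b : T) : Prop :=
  forall x, m x b = b.

Definition lat_hom (S T : Type) (mS jS : S -> S -> S) (mT jT : T -> T -> T)
  (f : S -> T) : Prop :=
  forall x y, f (mS x y) = mT (f x) (f y) /\ f (jS x y) = jT (f x) (f y).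

Definition is_lat_coproduct (A B C : Type)
  (mA jA : A -> A -> A) (mB jB : B -> B -> B) (mC jC : C -> C -> C)
  (i1 : A -> C) (i2 : B -> C) : Prop :=
  is_lattice mC jC /\ lat_hom mA jA mC jC i1 /\ lat_hom mB jB mC jC i2 /\
  forall (M : Type) (mM jM : M -> M -> M), is_lattice mM jM ->
  forall (f : A -> M) (g : B -> M),
    lat_hom mA jA mM jM f -> lat_hom mB jB mM jM g ->
    exists h : C -> M,
      lat_hom mC jC mM jM h /\ (forall a, h (i1 a) = f a) /\ (forall b, h (i2 b) = g b) /\
      (forall h' : C -> M, lat_hom mC jC mM jM h' ->
         (forall a, h' (i1 a) = f a) -> (forall b, h' (i2 b) = g b) ->
         forall c, h' c = h c).

Definition is_lat1_coproduct (A B C : Type)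
  (mA jA : A -> A -> A) (tA : A) (mB jB : B -> B -> B) (tB : B)
  (mC jC : C -> C -> C) (tC : C)
  (i1 : A -> C) (i2 : B -> C) : Prop :=
  is_lattice mC jC /\ is_top mC tC /\
  lat_hom mA jA mC jC i1 /\ i1 tA = tC /\
  lat_hom mB jB mC jC i2 /\ i2 tB = tC /\
  forall (M : Type) (mM jM : M -> M -> M) (tM : M), is_lattice mM jM -> is_top mM tM ->
  forall (f : A -> M) (g : B -> M),
    lat_hom mA jA mM jM f -> f tA = tM -> lat_hom mB jB mM jM g -> g tB = tM ->
    exists h : C -> M,
      lat_hom mC jC mM jM h /\ h tC = tM /\
      (forall a, h (i1 a) = f a) /\ (forall b, h (i2 b) = g b) /\
      (forall h' : C -> M, lat_hom mC jC mM jM h' -> h' tC = tM ->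
         (forall a, h' (i1 a) = f a) -> (forall b, h' (i2 b) = g b) ->
         forall c, h' c = h c).

Definition zero_one_embedding (S T : Type) (mS jS : S -> S -> S)
  (mT jT : T -> T -> T) (bT tT : T) (f : S -> T) : Prop :=
  lat_hom mS jS mT jT f /\
  (forall x y, f x = f y -> x = y) /\
  (forall b, is_bot mS b -> f b = bT) /\
  (forall t, is_top mS t -> f t = tT).

Definition infinite (Omega : Type) : Prop :=
  ~ exists l : list Omega, forall x, In x l.

Definition EqRel (Omega : Type) := { R : relation Omega | equivalence Omega R }.

Definition eq_meet_rel (Omega : Type) (R S : relation Omega) : relation Omega :=
  fun x y => R x y /\ S x y.

Definition eq_join_rel (Omega : Type) (R S : relation Omega) : relation Omega :=
  fun x y => forall E : relation Omega, equivalence Omega E ->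
    (forall a b, R a b -> E a b) -> (forall a b, S a b -> E a b) -> E x y.

Lemma eq_meet_equiv (Omega : Type) (R S : EqRel Omega) :
  equivalence Omega (eq_meet_rel (proj1_sig R) (proj1_sig S)).
Proof.
  destruct R as [R [HR1 HR2 HR3]], S as [S [HS1 HS2 HS3]]; simpl.
  split; unfold eq_meet_rel.
  - intro x; split; auto.
  - intros x y z [] []; split; eauto.
  - intros x y []; split; auto.
Qed.

Lemma eq_join_equiv (Omega : Type) (R S : EqRel Omega) :
  equivalence Omega (eq_join_rel (proj1_sig R) (proj1_sig S)).
Proof.
  split; unfold eq_join_rel.
  - intros x E [HE1 _ _] _ _; apply HE1.
  - intros x y z Hxy Hyz E HE H1 H2.
    destruct HE as [HE1 HE2 HE3].
    apply HE2 with y; [apply Hxy | apply Hyz]; auto; split; auto.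
  - intros x y Hxy E HE H1 H2.
    destruct HE as [HE1 HE2 HE3].
    apply HE3; apply Hxy; auto; split; auto.
Qed.

Definition eq_meet (Omega : Type) (R S : EqRel Omega) : EqRel Omega :=
  exist _ _ (eq_meet_equiv R S).

Definition eq_join (Omega : Type) (R S : EqRel Omega) : EqRel Omega :=
  exist _ _ (eq_join_equiv R S).

Lemma eq_id_equiv (Omega : Type) : equivalence Omega (@eq Omega).
Proof. split; red; intros; subst; auto. Qed.
Definition eq_bot (Omega : Type) : EqRel Omega := exist _ _ (eq_id_equiv Omega).

Lemma eq_full_equiv (Omega : Type) : equivalence Omega (fun _ _ => True).
Proof. split; red; intros; auto. Qed.
Definition eq_top (Omega : Type) : EqRel Omega := exist _ _ (eq_full_equiv Omega).

Definition eqop_meet (Omega : Type) := @eq_join Omega.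
Definition eqop_join (Omega : Type) := @eq_meet Omega.
Definition eqop_top (Omega : Type) := eq_bot Omega.
Definition eqop_bot (Omega : Type) := eq_top Omega.

(* Main.v *)
From Stdlib Require Import List Relation_Definitions Lia.
From mathcomp Require Import ssreflect ssrfun ssrbool eqtype seq choice.
From mathcomp Require Import boolp classical_sets functions cardinality.
Require Import Defs.

(** Dually, a coproduct of two copies of the lattice [E] of equivalence relations on [Omega]
    (with common least element, or without) has to be embedded into [E].  The point is that [E] is
    algebraic, and that its compact elements, the equivalence relations with finite support, form
    a sublattice [K] of cardinality [|Omega|].

    Lattice terms over two copies of [K], preordered by Whitman's solution of the word problem for
    free products, form a lattice [D] of cardinality [|Omega|].  Replacing the leaves of a term
    [p] over [E] by compact elements below them gives the approximants of [p], and [p] acts as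
    the ideal of [D] they generate.  By induction along Whitman's condition, with a pigeonhole
    argument on its finitely many rules at each step, inclusion of these ideals implies the
    inequality of the terms in any lattice receiving two copies of [E].

    It remains to represent the ideals of [D] by equivalence relations on a set of size [|Omega|].
    Start with a star having an edge labelled [t] for each [t] in [D], and repeatedly attach to
    every edge labelled [l], for all [a], [b] with [l <= a \/ b], a path with labels [a], [b],
    [a], [b] joining its ends.  Being connected by edges with labels below [c] then depends on [c]
    compatibly with meets and joins. *)

Set Implicit Arguments.
Unset Strict Implicit.
Unset Printing Implicit Defensive.
Local Open Scope classical_set_scope.

(** * Cardinal arithmetic *)

Definition embeds (A B : Type) : Prop := exists f : A -> B, injective f.

Lemma embeds_trans A B C : embeds A B -> embeds B C -> embeds A C.
Proof. by move=> [f fi] [g gi]; exists (g \o f) => x y /gi /fi. Qed.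

Lemma embeds_antisym A B : embeds A B -> embeds B A ->
  exists (f : A -> B) (g : B -> A), cancel f g /\ cancel g f.
Proof.
have card_le X Y : embeds X Y -> ([set: X] #<= [set: Y])%card.
  move=> [f fi]; apply/card_leP/injfunPex.
  exists (fun x => SigSub (mem_set (I : [set: Y] (f (val x))))) => //.
  by move=> x y _ _ /(congr1 val) /= /fi; apply: val_inj.
move=> /card_le AB /card_le BA.
have /card_eqP [h] := Cantor_Bernstein AB BA.
pose f a := val (h (SigSub (mem_set (I : [set: A] a)))).
have fi : injective f by move=> x y /val_inj /inj; rewrite !in_setT => /(_ isT isT)[].
have fs b : exists a, f a = b.
  have [a _ e] := (@surj _ _ _ _ h) (SigSub (mem_set (I : [set: B] b))) I.
  exists (val a); rewrite -[RHS]/(val (SigSub (mem_set (I : [set: B] b)))) -e /f.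
  by congr (val (h _)); apply: val_inj.
have [g gP] := choice fs; exists f, g; split=> // x.
by apply: fi; rewrite gP.
Qed.

(** A maximal partial injection between the two sets, given by Zorn's lemma, is total on one side:
    unmatched points [a] and [b] on both sides could be added as a new pair. The values of [f]
    outside the given set are arbitrary. *)
Lemma card_le_total T (A B : set T) :
  (exists f : T -> T, (forall x, A x -> B (f x)) /\
     forall x y, A x -> A y -> f x = f y -> x = y) \/
  (exists f : T -> T, (forall x, B x -> A (f x)) /\
     forall x y, B x -> B y -> f x = f y -> x = y).
Proof.
pose P (G : set (T * T)) :=
  (forall p, G p -> A p.1 /\ B p.2) /\
  forall p q, G p -> G q -> (p.1 = q.1 <-> p.2 = q.2).
have [F FP Ftot|G [[GAB Ginj] Gmax]] := @Zorn_bigcup _ P.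
  split=> [p [G /FP[GAB _] /GAB]//|p q [G FG Gp] [H FH Hq]].
  by have [GH|HG] := Ftot _ _ FG FH;
    [apply: (FP _ FH).2 => //; exact: GH|apply: (FP _ FG).2 => //; exact: HG].
have [Adom|/existsNP[a /not_implyP[Aa Ga]]] :=
    pselect (forall x, A x -> exists y, G (x, y)).
  left; have /choice[f fG] : forall x, exists y, A x -> G (x, y).
    by move=> x; have [/Adom[y]|] := pselect (A x); [exists y|exists x].
  exists f; split=> [x /fG/GAB[]//|x y /fG Gx /fG Gy].
  by have [_] := Ginj _ _ Gx Gy.
have [Bdom|/existsNP[b /not_implyP[Bb Gb]]] :=
    pselect (forall y, B y -> exists x, G (x, y)).
  right; have /choice[f fG] : forall y, exists x, B y -> G (x, y).
    by move=> y; have [/Bdom[x]|] := pselect (B y); [exists x|exists y].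
  exists f; split=> [x /fG/GAB[]//|x y /fG Gx /fG Gy].
  by have [+ _] := Ginj _ _ Gx Gy.
have [] := Gmax (G `|` [set (a, b)]).
- split=> [|/(_ (a, b) (or_intror erefl)) Gab]; first by left.
  by apply: Ga; exists b.
- split=> [p [/GAB//|->//]|p q [Gp|->] [Gq|->]//=]; first exact: Ginj.
    split=> e; [case: Ga; exists p.2|case: Gb; exists p.1];
      by rewrite -e; case: p Gp {e}.
  split=> e; [case: Ga; exists q.2|case: Gb; exists q.1];
    by rewrite e; case: q Gq {e}.
Qed.

Lemma infinite_nat_embeds T : infinite T -> embeds nat T.
Proof.
move=> infT; have infT' : infinite_set [set: T].
  elim/Peq: T infT => T infT /finite_seqP[s Ts]; apply: infT; exists s => x.
  have : x \in s by have : [set: T] x by []; rewrite Ts.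
  by elim: s {Ts} => // y l IH; rewrite in_cons => /orP[/eqP ->|/IH]; [left|right].
elim/Ppointed: T infT infT' => T infT; first by move=> _; case: infT; exists nil => x; have := no x.
by move=> /infiniteP/pcard_injP[f fi]; exists f => m n; apply: fi; rewrite in_setT.
Qed.

(* Zorn's lemma gives a maximal pairing [K] on a subset [dom K].  If the complement of [dom K]
   embeds into [dom K], then so does [T]; otherwise [K] extends to a disjoint copy of [dom K]. *)
Lemma infinite_square_embeds T : infinite T -> embeds (T * T) T.
Proof.
move=> infT; have [g gi] := infinite_nat_embeds infT.
have [pr pri] : embeds (nat * nat) nat.
  by exists pickle => x y; apply: (pcan_inj pickleK).
(* [H] is the graph of a pairing on [dom H], a set read off from the diagonal; the equivalence in
   [P] says at once that it is single-valued and injective. *)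
pose dom (H : set (T * T * T)) x := exists z, H (x, x, z).
pose P (H : set (T * T * T)) := [/\
  forall p, H p -> dom H p.1.1 /\ dom H p.1.2 /\ dom H p.2,
  forall x y, dom H x -> dom H y -> exists z, H (x, y, z) &
  forall p q, H p -> H q -> (p.1 = q.1 <-> p.2 = q.2)].
have Pchain (F : set (set (T * T * T))) : F `<=` P -> total_on F subset ->
    P (\bigcup_(X in F) X).
  move=> FP Ftot; have common G H : F G -> F H -> exists2 K, F K & G `<=` K /\ H `<=` K.
    by move=> FG FH; have [GH|HG] := Ftot _ _ FG FH;
      [exists H; [|split]|exists G; [|split]].
  split.
  - move=> p [H FH Hp]; have [Hdom _ _] := FP _ FH.
    have domU x : dom H x -> dom (\bigcup_(X in F) X) x by move=> [z ?]; exists z, H.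
    by have [? [? ?]] := Hdom _ Hp; split; [|split]; exact: domU.
  - move=> x y [u [G FG Gu]] [v [H FH Hv]].
    have [K FK [GK HK]] := common _ _ FG FH; have [_ Kex _] := FP _ FK.
    by have [||z Kz] := Kex x y; [exists u; exact: GK|exists v; exact: HK|exists z; exists K].
  - move=> p q [G FG Gp] [H FH Hq]; have [K FK [GK HK]] := common _ _ FG FH.
    by have [_ _ Kinj] := FP _ FK; apply: Kinj; [exact: GK|exact: HK].
(* The pairing of the natural numbers, copied into [T], is kept inside every competitor, so that
   [dom K] contains the distinct tags [g 0] and [g 1]. *)
pose G0 : set (T * T * T) := [set p | exists m n, p = (g m, g n, g (pr (m, n)))].
have domG0 m : dom G0 (g m) by exists (g (pr (m, m))), m, m.
have PG0 : P G0.
  split.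
  - by move=> _ [m [n ->]] /=.
  - by move=> x y [_ [m [_ [-> _ _]]]] [_ [n [_ [-> _ _]]]]; exists (g (pr (m, n))), m, n.
  - by move=> _ _ [m [n ->]] [m' [n' ->]] /=; split=> [[/gi-> /gi->]|/gi/pri[-> ->]].
have [F FP Ftot|H [PH Hmax]] := @Zorn_bigcup _ (fun H => P (G0 `|` H)).
  (* [G0] is made a member of the chain, which covers the empty chain as well. *)
  have -> : G0 `|` \bigcup_(X in F) X =
      \bigcup_(X in [set X | X = G0 \/ exists2 Y, F Y & X = G0 `|` Y]) X.
    apply/seteqP; split=> [p [G0p|[X FX Xp]]|p [X [->|[Y FY ->]]]].
    - by exists G0 => //; left.
    - by exists (G0 `|` X); [right; exists X|right].
    - by left.
    - by move=> [|Yp]; [left|right; exists Y].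
  apply: Pchain => [X [->//|[Y FY ->]]|]; first exact: FP.
  move=> X Y [->|[X' FX' ->]] [->|[Y' FY' ->]]; [by left|by left; left|by right; left|].
  by have [XY|YX] := Ftot _ _ FX' FY'; [left|right]; apply: setUS.
move: PH; set K := G0 `|` H => PK; have [Kdom Kex Kinj] := PK.
have /choice[j' jP'] : forall p : T * T, exists z, dom K p.1 -> dom K p.2 -> K (p, z).
  move=> [x y]; have [[Kx Ky]|nK] := pselect (dom K x /\ dom K y).
    by have [z] := Kex _ _ Kx Ky; exists z.
  by exists x => /= Kx Ky; case: nK.
pose j x y := j' (x, y).
have jP x y : dom K x -> dom K y -> K (x, y, j x y) by exact: (jP' (x, y)).
have jdom x y : dom K x -> dom K y -> dom K (j x y).
  by move=> Kx Ky; have [_ []] := Kdom _ (jP _ _ Kx Ky).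
have jinj x y x' y' : dom K x -> dom K y -> dom K x' -> dom K y' ->
    j x y = j x' y' -> x = x' /\ y = y'.
  move=> Kx Ky Kx' Ky' e.
  by have [_ /(_ e) []] := Kinj _ _ (jP _ _ Kx Ky) (jP _ _ Kx' Ky').
have domK m : dom K (g m).
  by have [z Gz] := domG0 m; exists z; left.
(* The tag [g 0] marks the points of [dom K] and [g 1] the others, which [f] first moves into
   [dom K]. *)
have tagged (D : set T) (f : T -> T) : (forall x, D x -> ~ dom K x -> dom K (f x)) ->
    (forall x y, D x -> D y -> ~ dom K x -> ~ dom K y -> f x = f y -> x = y) ->
    exists e : T -> T, (forall x, D x -> dom K (e x)) /\
      forall x y, D x -> D y -> e x = e y -> x = y.
  move=> fK fi; exists (fun x => if pselect (dom K x) then j (g 0) x else j (g 1) (f x)).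
  split=> [x Dx|x y Dx Dy]; first by case: pselect => ?; apply: jdom => //; exact: fK.
  case: pselect => Kx; case: pselect => Ky e.
  - by have [] := jinj _ _ _ _ (domK 0) Kx (domK 0) Ky e.
  - by have [/gi] := jinj _ _ _ _ (domK 0) Kx (domK 1) (fK _ Dy Ky) e.
  - by have [/gi] := jinj _ _ _ _ (domK 1) (fK _ Dx Kx) (domK 0) Ky e.
  - by have [_ /fi] := jinj _ _ _ _ (domK 1) (fK _ Dx Kx) (domK 1) (fK _ Dy Ky) e; apply.
have [[f [fK fi]]|[f [fK fi]]] := card_le_total (~` dom K) (dom K).
  have [||e [eK ei]] := tagged setT f; [by move=> x _; exact: fK|by move=> x y _ _; exact: fi|].
  exists (fun p => j (e p.1) (e p.2)) => -[x y] [x' y'] /= exy.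
  have [] := jinj _ _ _ _ (eK x I) (eK y I) (eK x' I) (eK y' I) exy.
  by move=> /ei-> // /ei->.
pose D x := dom K x \/ exists2 y, dom K y & x = f y.
have [h hP] : exists h : T -> T, forall x, dom K x -> h (f x) = x.
  have /choice[h hP] : forall y, exists x, forall x', dom K x' -> f x' = y -> x' = x.
    move=> y; have [[x [Kx <-]]|nx] := pselect (exists x, dom K x /\ f x = y).
      by exists x => x' Kx' /fi; exact.
    by exists y => x' Kx' e; case: nx; exists x'.
  by exists h => x Kx; rewrite -(hP _ _ Kx erefl).
have [||e [eK ei]] := tagged D h.
- by move=> x [//|[y Ky ->]] _; rewrite hP.
- move=> x y Dx Dy nKx nKy; case: Dx => [/nKx//|[x' Kx' ->]]; case: Dy => [/nKy//|[y' Ky' ->]].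
  by rewrite !hP // => ->.
(* New pairs, with at least one coordinate in the copy of [dom K], get values in that copy, so that
   they cannot clash with the old values. *)
pose L : set (T * T * T) := [set p | [/\ D p.1.1, D p.1.2, ~ (dom K p.1.1 /\ dom K p.1.2) &
   p.2 = f (j (e p.1.1) (e p.1.2))]].
have domKL x : dom (K `|` L) x <-> D x.
  split=> [[z [Kz|[Dx _ _ _]]]|[Kx|[y Ky ->]]].
  - by left; exists z.
  - exact: Dx.
  - by have [z] := Kx; exists z; left.
  - exists (f (j (e (f y)) (e (f y)))); right; split => //=; try (by right; exists y).
    by case=> /(fK _ Ky).
have LK p : L p -> ~ dom K p.2.
  by case=> D1 D2 _ ->; apply: fK; apply: jdom; exact: eK.
have [] := Hmax (K `|` L).
- split=> [|KLH]; first by move=> p Hp; left; right.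
  (* The copy is nonempty, so [L] has an element with value outside [dom K]: the extension is
     proper. *)
  have Df : D (f (g 0)) by right; exists (g 0).
  have nK0 := fK _ (domK 0).
  pose p := (f (g 0), f (g 0), f (j (e (f (g 0))) (e (f (g 0))))).
  have Lp : L p by split=> // -[].
  have Kp : K p by right; apply: KLH; right.
  by have [_ [_ /(LK _ Lp)]] := Kdom _ Kp.
- have -> : G0 `|` (K `|` L) = K `|` L by rewrite setUA /K setUA setUid.
  split.
  + move=> p [Kp|[D1 D2 _ ->]].
      by have [? [? ?]] := Kdom _ Kp; split; [|split]; apply/domKL; left.
    split; [|split]; apply/domKL => //; right; exists (j (e p.1.1) (e p.1.2)) => //.
    by apply: jdom; exact: eK.
  + move=> x y /domKL Dx /domKL Dy; have [[Kx Ky]|nK] := pselect (dom K x /\ dom K y).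
      by have [z] := Kex _ _ Kx Ky; exists z; left.
    by exists (f (j (e x) (e y))); right.
  + move=> p q [Kp|Lp] [Kq|Lq]; first exact: Kinj.
    * have [? [? ?]] := Kdom _ Kp; split=> epq; last by case: (LK _ Lq); rewrite -epq.
      by case: Lq => _ _ []; rewrite -epq.
    * have [? [? ?]] := Kdom _ Kq; split=> epq; last by case: (LK _ Lp); rewrite epq.
      by case: Lp => _ _ []; rewrite epq.
    * case: Lp => p1 p2 _ ->; case: Lq => q1 q2 _ ->; split=> [->//|].
      have jd (r : T * T * T) : D r.1.1 -> D r.1.2 -> dom K (j (e r.1.1) (e r.1.2)).
        by move=> *; apply: jdom; exact: eK.
      move=> /(fi _ _ (jd p p1 p2) (jd q q1 q2)).
      move=> /(jinj _ _ _ _ (eK _ p1) (eK _ p2) (eK _ q1) (eK _ q2)).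
      by case: p q p1 p2 q1 q2 => [[? ?] ?] [[? ?] ?] /= ? ? ? ? [/ei-> // /ei->].
Qed.

(** * The word problem for coproducts *)

(** A lattice up to equivalence: the order is a preorder, so that terms can be compared without
    forming a quotient. *)
Record prelattice := PreLattice {
  car :> Type;
  le : car -> car -> Prop;
  meet : car -> car -> car;
  join : car -> car -> car;
  le_refl : forall x, le x x;
  le_trans : forall y x z, le x y -> le y z -> le x z;
  meet_l : forall x y, le (meet x y) x;
  meet_r : forall x y, le (meet x y) y;
  meet_glb : forall x y z, le z x -> le z y -> le z (meet x y);
  join_l : forall x y, le x (join x y);
  join_r : forall x y, le y (join x y);
  join_lub : forall x y z, le x z -> le y z -> le (join x y) z }.

Record bprelattice := BPreLattice {
  bcar :> prelattice;
  bot : bcar;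
  bot_le : forall x, le bot x }.
Arguments bot {_}.

#[local] Hint Resolve le_refl meet_l meet_r join_l join_r bot_le : core.

Lemma le_meet (L : prelattice) (x y x' y' : L) :
  le x x' -> le y y' -> le (meet x y) (meet x' y').
Proof.
by move=> h h'; apply: meet_glb; [apply: le_trans h|apply: le_trans h'].
Qed.

Lemma le_join (L : prelattice) (x y x' y' : L) :
  le x x' -> le y y' -> le (join x y) (join x' y').
Proof.
by move=> h h'; apply: join_lub; [apply: (le_trans h)|apply: (le_trans h')].
Qed.

Section WithTop.
Variable L : bprelattice.

Definition top_le (x y : option L) : Prop :=
  match x, y with
  | _, None => True
  | None, Some _ => False
  | Some a, Some b => le a b
  end.

Definition top_meet (x y : option L) : option L :=
  match x, y with
  | None, y => y
  | x, None => x
  | Some a, Some b => Some (meet a b)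
  end.

Definition top_join (x y : option L) : option L :=
  match x, y with
  | Some a, Some b => Some (join a b)
  | _, _ => None
  end.

Definition with_top_pre : prelattice.
Proof.
apply: (@PreLattice (option L) top_le top_meet top_join).
- by move=> [x|] /=.
- by move=> [y|] [x|] [t|] //=; apply: le_trans.
- by move=> [x|] [y|] /=.
- by move=> [x|] [y|] /=.
- by move=> [x|] [y|] [t|] //=; apply: meet_glb.
- by move=> [x|] [y|] /=.
- by move=> [x|] [y|] /=.
- by move=> [x|] [y|] [t|] //=; apply: join_lub.
Defined.

Definition with_top : bprelattice.
Proof. by apply: (@BPreLattice with_top_pre (Some bot)) => -[x|] /=. Defined.

Lemma top_le_Some (a b : L) : @le with_top (Some a) (Some b) = le a b.
Proof. by []. Qed.

End WithTop.

(* With [z] the new bottom [None] is identified with the old one, so that one development covers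
   the coproduct with a common bottom ([z]) and the coproduct of all lattices ([~ z]). *)
Section WithBot.
Variables (z : Prop) (L : bprelattice).

Definition bot_rel (x y : option L) : Prop :=
  match x, y with
  | None, _ => True
  | Some a, None => z /\ le a bot
  | Some a, Some b => le a b
  end.

Definition bot_meet (x y : option L) : option L :=
  match x, y with
  | Some a, Some b => Some (meet a b)
  | _, _ => None
  end.

Definition bot_join (x y : option L) : option L :=
  match x, y with
  | None, y => y
  | x, None => x
  | Some a, Some b => Some (join a b)
  end.

Definition with_bot_pre : prelattice.
Proof.
apply: (@PreLattice (option L) bot_rel bot_meet bot_join).
- by move=> [x|] /=.
- move=> [y|] [x|] [t|] //=.
  + exact: le_trans.
  + by move=> xy [hz yb]; split=> //; exact: le_trans yb.
  + by move=> [_ xb] _; exact: le_trans (bot_le _).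
- by move=> [x|] [y|] /=.
- by move=> [x|] [y|] /=.
- move=> [x|] [y|] [t|] //=; first exact: meet_glb.
- by move=> [x|] [y|] /=.
- by move=> [x|] [y|] /=.
- move=> [x|] [y|] [t|] //=; first exact: join_lub.
  by move=> [hz xb] [_ yb]; split=> //; exact: join_lub.
Defined.

Definition with_bot : bprelattice.
Proof. by apply: (@BPreLattice with_bot_pre None) => -[x|] /=. Defined.

End WithBot.

Inductive term (X : Type) : Type :=
| Leaf of bool & X
| Meet of term X & term X
| Join of term X & term X.
Arguments Leaf {X}.

Fixpoint term_size (X : Type) (p : term X) : nat :=
  match p with
  | Leaf _ _ => 1
  | Meet p q | Join p q => S (term_size p + term_size q)
  end.

(* [up p i] is the least element above [p] in the [i]-th copy of [B], with [None] if there is none,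
   and [dn p i] the greatest element below [p].  The two copies share their bottom, whence the
   normalization [nrm]: a meet may reach the bottom inside one copy only. *)
Section Whitman.
Variables (B : bprelattice) (X : Type) (lam : X -> B).
Notation T := (with_top B).

Definition nrm (f : bool -> T) (i : bool) : T :=
  if pselect (exists j, le (f j) bot) then bot else f i.

Fixpoint up (p : term X) : bool -> T :=
  match p with
  | Leaf j x => nrm (fun i => if i == j then Some (lam x) else None)
  | Meet p q => nrm (fun i => meet (up p i) (up q i))
  | Join p q => fun i => join (up p i) (up q i)
  end.

Fixpoint dn (p : term X) (i : bool) : B :=
  match p with
  | Leaf j x => if i == j then lam x else bot
  | Meet p q => meet (dn p i) (dn q i)
  | Join p q => join (dn p i) (dn q i)
  end.

(* Whitman's condition for the coproduct of two copies of [B] with common bottom. *)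
Inductive W : term X -> term X -> Prop :=
| W_leaf i p q : le (up p i) (Some (dn q i)) -> W p q
| W_joinl p1 p2 q : W p1 q -> W p2 q -> W (Join p1 p2) q
| W_meetl1 p1 p2 q : W p1 q -> W (Meet p1 p2) q
| W_meetl2 p1 p2 q : W p2 q -> W (Meet p1 p2) q
| W_joinr1 p q1 q2 : W p q1 -> W p (Join q1 q2)
| W_joinr2 p q1 q2 : W p q2 -> W p (Join q1 q2)
| W_meetr p q1 q2 : W p q1 -> W p q2 -> W p (Meet q1 q2).

Lemma nrm_zero f j : le (f j) bot -> nrm f = fun=> bot.
Proof.
by move=> fj; apply: funext => i; rewrite /nrm; case: pselect => // -[]; exists j.
Qed.

Lemma nrm_pos f : (forall j, ~ le (f j) bot) -> nrm f = f.
Proof.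
move=> nf; apply: funext => i; rewrite /nrm; case: pselect => // h.
by exfalso; case: h => j /nf.
Qed.

Lemma nrmP f : (exists2 j, le (f j) bot & nrm f = fun=> bot) \/
  ((forall j, ~ le (f j) bot) /\ nrm f = f).
Proof.
have [[j fj]|nf] := EM (exists j, le (f j) bot).
  by left; exists j => //; exact: (nrm_zero fj).
have nf' j : ~ le (f j) bot by move=> fj; apply: nf; exists j.
by right; split=> //; exact: nrm_pos.
Qed.

Lemma nrm_le f i : le (nrm f i) (f i).
Proof. by have [[j _ ->]|[_ ->]] := nrmP f; [exact: bot_le|exact: le_refl]. Qed.

Lemma nrm_glb f t : (forall i, le (t i) (f i)) ->
  (forall i j, le (t j) bot -> le (t i) bot) -> forall i, le (t i) (nrm f i).
Proof.
move=> tf tn i; have [[j fj ->]|[_ ->]] := nrmP f; last exact: tf.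
by apply: (tn _ j); apply: le_trans fj.
Qed.

Lemma nrm_norm f i j : le (nrm f j) bot -> le (nrm f i) bot.
Proof.
by have [[k _ ->]|[nf ->]] := nrmP f; [move=> _; exact: le_refl|move/nf].
Qed.

Lemma up_norm p i j : le (up p j) bot -> le (up p i) bot.
Proof.
elim: p => [k x|p IHp q IHq|p IHp q IHq]; [exact: nrm_norm|exact: nrm_norm|].
by move=> h; apply: join_lub; [apply: IHp|apply: IHq];
  apply: le_trans h; [exact: join_l|exact: join_r].
Qed.

(** A nonzero element of one copy has no upper bound in the other, as the copies share only their
    bottom. The case of a meet needs both claims at once. *)
Lemma dn_up p : (forall i, le (Some (dn p i) : T) (up p i)) /\
  (forall i j, i != j -> ~ le (dn p i) bot -> up p j = None).
Proof.
elim: p => [k x|p [p1 p2] q [q1 q2]|p [p1 p2] q [q1 q2]] /=.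
- set f := fun i : bool => _.
  have [[j fj ->]|[_ ->]] := nrmP f.
    have xb : le (lam x) bot by move: fj; rewrite /f; case: eqP.
    have b i : le (if i == k then lam x else bot) bot by case: eqP => // _; exact: le_refl.
    by split=> [i|i j' _ []]; [exact: b i|exact: b].
  rewrite /f {f}; split=> [i|i j ij]; first by case: eqP => //= _; exact: le_refl.
  case: eqP => [<- nx|_]; last by move/(_ (le_refl _)).
  by rewrite eq_sym (negbTE ij).
- set f := fun i => meet (up p i) (up q i).
  have fd i : le (Some (meet (dn p i) (dn q i)) : T) (f i).
    exact: (@le_meet T (Some _) (Some _)).
  have fN i j : i != j -> ~ le (meet (dn p i) (dn q i)) bot -> f j = None.
    move=> ij nb; rewrite /f (p2 i j ij) ?(q2 i j ij) // => h; apply: nb;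
      by apply: le_trans h.
  have [[j fj ->]|[_ ->]] := nrmP f; last by [].
  have b i : le (meet (dn p i) (dn q i)) bot.
    apply: contrapT => nb; have [ij|ij] := eqVneq i j; last by move: fj; rewrite (fN i j).
    by apply: nb; rewrite ij; exact: le_trans (fd j) fj.
  by split=> // i j' _ /(_ (b i)).
- split=> [i|i j ij nb]; first exact: (@le_join T (Some _) (Some _)).
  have [pb|pb] := pselect (le (dn p i) bot); last by rewrite (p2 i j ij pb).
  have [qb|qb] := pselect (le (dn q i) bot); last by rewrite (q2 i j ij qb); case: (up p j).
  by case: nb; exact: join_lub.
Qed.

(** In the leaf rule through copy [j], the other copy is settled by [dn_up]: if [dn q j] is a
    bottom, all bounds of [p] collapse, and otherwise [up q i] is [None]. *)
Lemma W_mono p q : W p q ->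
  (forall i, le (up p i) (up q i)) /\ (forall i, le (dn p i) (dn q i)).
Proof.
elim=> {p q}.
- move=> j p q h; have [pd pc] := dn_up p; have [qd qc] := dn_up q.
  have main i : le (up p i) (up q i) /\ le (dn p i) (dn q i).
    have [->|ij] := eqVneq i j.
      split; first exact: le_trans h (qd _).
      suff : @le T (Some (dn p j)) (Some (dn q j)) by [].
      exact: le_trans (pd _) h.
    have [qb|qb] := pselect (le (dn q j) bot).
      have pb : le (up p i) bot.
        by apply: (@up_norm _ _ j); apply: le_trans h _; rewrite top_le_Some.
      split; first exact: le_trans pb (bot_le _).
      suff : @le T (Some (dn p i)) (Some (dn q i)) by [].
      by apply: le_trans (pd _) _; apply: le_trans pb (bot_le _).
    split; first by rewrite (qc j i) 1?eq_sym //; case: (up p i).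
    have [pb|pb] := pselect (le (dn p i) bot); first exact: le_trans pb (bot_le _).
    by move: h; rewrite (pc i j).
  by split=> i; have [] := main i.
- by move=> p1 p2 q _ [u1 d1] _ [u2 d2]; split=> i; apply: join_lub.
- move=> p1 p2 q _ [u1 d1]; split=> i /=; last exact: le_trans (meet_l _ _) (d1 i).
  exact: le_trans (nrm_le _ _) (le_trans (meet_l _ _) (u1 i)).
- move=> p1 p2 q _ [u1 d1]; split=> i /=; last exact: le_trans (meet_r _ _) (d1 i).
  exact: le_trans (nrm_le _ _) (le_trans (meet_r _ _) (u1 i)).
- by move=> p q1 q2 _ [u1 d1]; split=> i; apply: le_trans (join_l _ _).
- by move=> p q1 q2 _ [u1 d1]; split=> i; apply: le_trans (join_r _ _).
- move=> p q1 q2 _ [u1 d1] _ [u2 d2]; split=> i; last exact: meet_glb.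
  by apply: nrm_glb => [j|j k]; [apply: meet_glb|apply: up_norm].
Qed.

Lemma W_refl p : W p p.
Proof.
elim: p => [i x|p IHp q IHq|p IHp q IHq].
- apply: (W_leaf (i := i)); apply: le_trans (nrm_le _ _) _ => /=.
  by rewrite eqxx; exact: le_refl.
- by apply: W_meetr; [apply: W_meetl1|apply: W_meetl2].
- by apply: W_joinl; [apply: W_joinr1|apply: W_joinr2].
Qed.

(** The rules are grouped into the leaf rule, those taking [p] apart and those taking [q] apart, the
    form in which transitivity and separation use them. *)
Lemma W_inv p q : W p q ->
  (exists i, le (up p i) (Some (dn q i))) \/
  match p with
  | Leaf _ _ => False
  | Join p1 p2 => W p1 q /\ W p2 q
  | Meet p1 p2 => W p1 q \/ W p2 q
  end \/
  match q with
  | Leaf _ _ => False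
  | Join q1 q2 => W p q1 \/ W p q2
  | Meet q1 q2 => W p q1 /\ W p q2
  end.
Proof. by case=> *; try (by left; eexists; eassumption); right; auto. Qed.

(** Cut elimination, by induction on the total size of the three terms. A rule acting on [p] or on
    [r] commutes with the cut; a leaf rule absorbs it by [W_mono]. *)
Lemma W_trans q p r : W p q -> W q r -> W p r.
Proof.
have [n] : exists n, (term_size p + term_size q + term_size r < n)%nat by eexists.
elim: n p q r => [|n IH] p q r; first by lia.
move=> sz pq qr; have [_ dqr] := W_mono qr; have [upq _] := W_mono pq.
have [[i h]|[hp|hq]] := W_inv pq.
- apply: (W_leaf (i := i)); apply: le_trans h _; rewrite top_le_Some; exact: dqr.
- case: p sz pq upq hp => [//|p1 p2|p1 p2] sz pq upq hp; simpl in sz.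
  + by case: hp => h; [apply: W_meetl1|apply: W_meetl2]; apply: (IH _ q r) => //; lia.
  + by case: hp => h1 h2; apply: W_joinl; apply: (IH _ q r) => //; lia.
have [[i h]|[hq'|hr]] := W_inv qr.
- by apply: (W_leaf (i := i)); apply: le_trans h.
(* The cut term is taken apart on both sides, and the two derivations meet in one of its immediate
   subterms. *)
- case: q sz pq qr upq dqr hq hq' => [//|q1 q2|q1 q2] sz pq qr upq dqr hq hq'; simpl in sz.
  + by case: hq => h1 h2; case: hq' => h; [apply: (IH p q1 r)|apply: (IH p q2 r)] => //; lia.
  + by case: hq' => h1 h2; case: hq => h; [apply: (IH p q1 r)|apply: (IH p q2 r)] => //; lia.
- case: r sz qr dqr hr => [//|r1 r2|r1 r2] sz qr dqr hr; simpl in sz.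
  + by case: hr => h1 h2; apply: W_meetr; apply: (IH p q) => //; lia.
  + by case: hr => h; [apply: W_joinr1|apply: W_joinr2]; apply: (IH p q) => //; lia.
Qed.

End Whitman.

(** * Approximation by compact elements *)

Fixpoint leafwise (X Y : Type) (R : X -> Y -> Prop) (p : term X) (q : term Y) : Prop :=
  match p, q with
  | Leaf i x, Leaf j y => i = j /\ R x y
  | Meet p1 p2, Meet q1 q2 => leafwise R p1 q1 /\ leafwise R p2 q2
  | Join p1 p2, Join q1 q2 => leafwise R p1 q1 /\ leafwise R p2 q2
  | _, _ => False
  end.

Section Leafwise.
Variables (B : bprelattice) (X Y : Type) (lx : X -> B) (ly : Y -> B).
Variable R : X -> Y -> Prop.
Hypothesis R_le : forall x y, R x y -> le (lx x) (ly y).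

Lemma leafwise_dn p q : leafwise R p q -> forall i, le (dn lx p i) (dn ly q i).
Proof.
elim: p q => [j x|p1 IH1 p2 IH2|p1 IH1 p2 IH2] [k y|q1 q2|q1 q2] //=.
- by move=> [-> /R_le xy] i; case: eqP.
- by move=> [/IH1 h1 /IH2 h2] i; exact: le_meet.
- by move=> [/IH1 h1 /IH2 h2] i; exact: le_join.
Qed.

End Leafwise.

Lemma leafwise_W (B : bprelattice) (X : Type) (lam : X -> B) p q :
  leafwise (fun x y => le (lam x) (lam y)) p q -> W lam p q.
Proof.
elim: p q => [j x|p1 IH1 p2 IH2|p1 IH1 p2 IH2] [k y|q1 q2|q1 q2] //=.
- move=> [-> xy]; apply: (W_leaf (i := k)); apply: le_trans (nrm_le _ _) _ => /=.
  by rewrite eqxx.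
- by move=> [/IH1 h1 /IH2 h2]; apply: W_meetr; [apply: W_meetl1|apply: W_meetl2].
- by move=> [/IH1 h1 /IH2 h2]; apply: W_joinl; [apply: W_joinr1|apply: W_joinr2].
Qed.

(** [lam] lists the compact elements: [basis_split] is compactness with respect to binary joins,
    [basis_dense] is algebraicity, and [basis_join] and [basis_meet] make them a sublattice up to
    equivalence. *)
Record is_basis (E : bprelattice) (X : Type) (lam : X -> E) : Prop := IsBasis {
  basis_bot : exists x, le (lam x) bot;
  basis_join : forall x y, exists w, le (lam x) (lam w) /\ le (lam y) (lam w) /\
    le (lam w) (join (lam x) (lam y));
  basis_meet : forall x y, exists w, le (meet (lam x) (lam y)) (lam w) /\
    le (lam w) (lam x) /\ le (lam w) (lam y);
  basis_split : forall x a b, le (lam x) (join a b) ->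
    exists y w, le (lam y) a /\ le (lam w) b /\ le (lam x) (join (lam y) (lam w));
  basis_dense : forall a b, (forall x, le (lam x) a -> le (lam x) b) -> le a b }.

Section Approximation.
Variables (z : Prop) (E : bprelattice) (X : Type) (lam : X -> E).
Hypothesis lamP : is_basis lam.

Notation B := (with_bot z E).
Notation T := (with_top B).
Definition leafX (x : X) : B := Some (lam x).
Definition leafE (a : E) : B := Some a.

Definition approx := leafwise (fun x a => le (lam x) a).
Definition tle := leafwise (fun x y => le (lam x) (lam y)).

Lemma tle_refl p : tle p p.
Proof. by elim: p => [i x|p IHp q IHq|p IHp q IHq] //=; split. Qed.

Lemma tle_trans q p r : tle p q -> tle q r -> tle p r.
Proof.
elim: p q r => [i x|p1 IH1 p2 IH2|p1 IH1 p2 IH2] [i' x'|q1 q2|q1 q2] [k y|r1 r2|r1 r2] //=.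
- by move=> [-> h] [-> h']; split=> //; exact: le_trans h'.
- by move=> [h1 h2] [h3 h4]; split; [apply: IH1 h3|apply: IH2 h4].
- by move=> [h1 h2] [h3 h4]; split; [apply: IH1 h3|apply: IH2 h4].
Qed.

Lemma approx_ex p : exists p', approx p' p.
Proof.
elim: p => [i a|p [p' ?] q [q' ?]|p [p' ?] q [q' ?]].
- have [x xb] := basis_bot lamP; exists (Leaf i x); split=> //.
  exact: le_trans (bot_le _).
- by exists (Meet p' q').
- by exists (Join p' q').
Qed.

Lemma approx_dir p p1 p2 : approx p1 p -> approx p2 p ->
  exists2 p3, approx p3 p & tle p1 p3 /\ tle p2 p3.
Proof.
elim: p p1 p2 => [i a|p IHp q IHq|p IHp q IHq] [i1 x1|p1 q1|p1 q1] [i2 x2|p2 q2|p2 q2] //=.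
- move=> [-> h1] [-> h2]; have [w [xw [yw wj]]] := basis_join lamP x1 x2.
  by exists (Leaf i w) => //; split=> //; apply: le_trans wj _; exact: join_lub.
- move=> [/IHp hp /IHq hq] [/hp[p3 ? []] ? ? /hq[q3 ? []]] ? ?.
  by exists (Meet p3 q3).
- move=> [/IHp hp /IHq hq] [/hp[p3 ? []] ? ? /hq[q3 ? []]] ? ?.
  by exists (Join p3 q3).
Qed.

(* [Q] holds for all sufficiently large approximants of [p]. *)
Definition ev (p : term E) (Q : term X -> Prop) : Prop :=
  exists2 p0, approx p0 p & forall p', approx p' p -> tle p0 p' -> Q p'.

Lemma ev_ex p Q : ev p Q -> exists2 p', approx p' p & Q p'.
Proof. by move=> [p0 ap h]; exists p0 => //; apply: h => //; exact: tle_refl. Qed.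

Lemma ev_all p (Q : term X -> Prop) : (forall p', approx p' p -> Q p') -> ev p Q.
Proof. by move=> h; have [p' ap] := approx_ex p; exists p' => // ? ? _; exact: h. Qed.

Lemma ev_imp p (Q Q' : term X -> Prop) :
  (forall p', approx p' p -> Q p' -> Q' p') -> ev p Q -> ev p Q'.
Proof. by move=> h [p0 ap hQ]; exists p0 => // p' ap' /hQ; auto. Qed.

Lemma ev_and p (Q Q' : term X -> Prop) : ev p Q -> ev p Q' -> ev p (fun p' => Q p' /\ Q' p').
Proof.
move=> [p1 a1 h1] [p2 a2 h2]; have [p3 a3 [t1 t2]] := approx_dir a1 a2.
by exists p3 => // p' a' t'; split; [apply: h1|apply: h2] => //; exact: tle_trans t'.
Qed.

Lemma ev_Meet p q (Q Q' : term X -> Prop) : ev p Q -> ev q Q' ->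
  ev (Meet p q) (fun r => if r is Meet p' q' then Q p' /\ Q' q' else False).
Proof.
move=> [p0 a h] [q0 a' h']; exists (Meet p0 q0) => // -[//|p' q' [? ?] [? ?]|//].
by split; [apply: h|apply: h'].
Qed.

Lemma ev_Join p q (Q Q' : term X -> Prop) : ev p Q -> ev q Q' ->
  ev (Join p q) (fun r => if r is Join p' q' then Q p' /\ Q' q' else False).
Proof.
move=> [p0 a h] [q0 a' h']; exists (Join p0 q0) => // -[//|//|p' q' [? ?] [? ?]].
by split; [apply: h|apply: h'].
Qed.

(** The top, the adjoined bottom and the basis elements: enough to test inequalities in [T], and
    small enough to split along joins. *)
Definition test (t : T) : Prop :=
  t = None \/ t = bot \/ exists x, t = Some (Some (lam x)).

Lemma test_dense (u v : T) : (forall t, test t -> le t u -> le t v) -> le u v.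
Proof.
case: u => [[a|]|] h; last by apply: h => //; left.
- case: v h => [[b|]|] h //.
  + apply: (basis_dense lamP) => x xa.
    by apply: (h (Some (Some (lam x)))) => //; right; right; exists x.
  + have zb x : le (lam x) a -> z /\ le (lam x) bot.
      by move=> xa; apply: (h (Some (Some (lam x)))) => //; right; right; exists x.
    split; last by apply: (basis_dense lamP) => x /zb[].
    have [x xb] := basis_bot lamP; have [] // := zb x; exact: le_trans xb (bot_le _).
- exact: (@bot_le T).
Qed.

Lemma test_split (t u v : T) : test t -> le t (join u v) ->
  exists t1 t2, [/\ test t1, test t2, le t1 u, le t2 v & le t (join t1 t2)].
Proof.
have tb : test bot by right; left.
case: u => [a|] tt; last by move=> _; exists None, bot; split=> //; [by left|case: t tt].
case: v => [b|]; last by move=> _; exists bot, None; split=> //; [by left|case: t tt].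
case: tt => [->//|[->|[x ->]]].
  by exists bot, bot; split=> //; exact: (@bot_le T).
have tx y : test (Some (Some (lam y))) by right; right; exists y.
case: a b => [a|] [b|] h.
- have [y [w [ya [wb xyw]]]] := basis_split lamP h.
  by exists (Some (Some (lam y))), (Some (Some (lam w))); split.
- by exists (Some (Some (lam x))), bot; split=> //=; exact: le_refl.
- by exists bot, (Some (Some (lam x))); split=> //=; exact: le_refl.
- by exists bot, bot.
Qed.

(** The delicate point is [nrm]: an approximant that is a bottom in one copy collapses in both.
    Unless [p] itself collapses, nonzero test elements keep all large approximants away from
    this. *)
Lemma up_cont p i t : test t -> le t (up leafE p i) -> ev p (fun p' => le t (up leafX p' i)).
Proof.
elim: p i t => [j a|p IHp q IHq|p IHp q IHq] i t tt.
- pose f : bool -> T := fun i => if i == j then Some (leafE a) else None.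
  rewrite [up leafE _]/= -/f; have [[k fk ->] tb|[nf ->] tf] := nrmP f.
    by apply: ev_all => p' _; apply: le_trans tb (bot_le _).
  (* [x0] keeps the leaf away from the bottom, and [x1] puts it above [t]; their join [w] does
     both. *)
  have [x0 x0a nx0] : exists2 x, le (lam x) a & ~ le (Some (Some (lam x)) : T) bot.
    apply: contrapT => nx; apply: (nf j); apply: test_dense => t' tt'.
    rewrite /f eqxx; case: tt' => [->|[->|[x ->]]] // xa.
    by apply: contrapT => nxb; apply: nx; exists x; [exact: xa|].
  have [x1 x1a tx1] : exists2 x, le (lam x) a & i = j -> le t (Some (Some (lam x))).
    have [ij|/eqP ij] := eqVneq i j; last by exists x0.
    move: tf; rewrite /f ij eqxx; case: tt => [->//|[->|[x ->]]].
      by move=> _; exists x0 => // _; exact: bot_le.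
    by move=> xa; exists x; [exact: xa|].
  have [w [x0w [x1w wj]]] := basis_join lamP x0 x1.
  exists (Leaf j w); first by split=> //; apply: le_trans wj _; exact: join_lub.
  move=> [j' y [-> ya] [_ wy]|//|//] /=.
  rewrite nrm_pos => [|k].
    case: eqP => ij; last by case: (t).
    by apply: le_trans (tx1 ij) _; exact: le_trans x1w wy.
  case: eqP => _ yb; last by [].
  by apply: nx0; apply: le_trans yb; exact: le_trans x0w wy.
- rewrite [up leafE _]/=; set f := fun i => _.
  have [[k fk ->] tb|[nf ->] tf] := nrmP f.
    by apply: ev_all => p' _; apply: le_trans tb (bot_le _).
  (* In either copy a nonzero test element stays below both factors of large approximants, so that
     their meet is not a bottom there. *)
  have pos j : ev (Meet p q) (fun r => if r is Meet p' q' then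
      ~ le (meet (up leafX p' j) (up leafX q' j)) bot else False).
    have [t' [tt' t'f] nt'] : exists2 t', test t' /\ le t' (f j) & ~ le t' bot.
      apply: contrapT => nt; apply: (nf j); apply: test_dense => t' tt' t'f.
      by apply: contrapT => nt'; apply: nt; exists t'.
    have ep := IHp j t' tt' (le_trans t'f (meet_l _ _)).
    have eq := IHq j t' tt' (le_trans t'f (meet_r _ _)).
    apply: ev_imp (ev_Meet ep eq) => -[//|p' q' _ [h1 h2]|//] h.
    by apply: nt'; apply: le_trans h; exact: meet_glb.
  have ep := IHp i t tt (le_trans tf (meet_l _ _)).
  have eq := IHq i t tt (le_trans tf (meet_r _ _)).
  apply: ev_imp (ev_and (ev_Meet ep eq) (ev_and (pos true) (pos false))).
  move=> [//|p' q' _ [[h1 h2] [ht hf]]|//].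
  have -> : up leafX (Meet p' q') = fun i => meet (up leafX p' i) (up leafX q' i).
    by apply: nrm_pos => -[].
  exact: meet_glb.
- move=> /(test_split tt)[t1 [t2 [tt1 tt2 h1 h2 h]]].
  apply: ev_imp (ev_Join (IHp i t1 tt1 h1) (IHq i t2 tt2 h2)).
  by move=> [//|//|p' q' _ [h1' h2']]; apply: le_trans h _; exact: le_join.
Qed.

(** * Values of terms in a lattice receiving two copies of [E] *)

Section Evaluation.
Variables (C : prelattice) (inj : bool -> E -> C).
Hypothesis inj_mono : forall i a b, le a b -> le (inj i a) (inj i b).
Hypothesis inj_meet : forall i a b, le (meet (inj i a) (inj i b)) (inj i (meet a b)).
Hypothesis inj_join : forall i a b, le (inj i (join a b)) (join (inj i a) (inj i b)).
Hypothesis inj_bot : forall i j, z -> le (inj i bot) (inj j bot).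

Fixpoint eval (p : term E) : C :=
  match p with
  | Leaf i a => inj i a
  | Meet p q => meet (eval p) (eval q)
  | Join p q => join (eval p) (eval q)
  end.

(** [C] need not have an element for the bottom adjoined to [E]. When [z] holds, [inj i bot]
    replaces it; otherwise nothing counts as below it and everything as above it. *)
Definition below (c : C) (i : bool) (b : B) : Prop :=
  match b with None => z /\ le c (inj i bot) | Some a => le c (inj i a) end.

Definition above (i : bool) (b : B) (c : C) : Prop :=
  match b with None => z -> le (inj i bot) c | Some a => le (inj i a) c end.

Lemma below_mono c i b b' : below c i b -> le b b' -> below c i b'.
Proof.
case: b b' => [b|] [b'|] //=.
- by move=> h /(inj_mono i); exact: le_trans h.
- by move=> h [hz /(inj_mono i) hb]; split=> //; exact: le_trans hb.
- by move=> [hz h] _; apply: le_trans h (inj_mono _ (bot_le _)).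
Qed.

Lemma below_above c i b b' c' : below c i b -> le b b' -> above i b' c' -> le c c'.
Proof.
move=> h /(below_mono h); case: b' => [b'|] /=; first exact: le_trans.
by move=> [hz h1] /(_ hz); exact: le_trans h1.
Qed.

Lemma below_nrm c (f : bool -> T) :
  (forall i b, le (f i) (Some b) -> below c i b) ->
  forall i b, le (nrm f i) (Some b) -> below c i b.
Proof.
move=> h i b; have [[j fj ->]|[_ ->]] := nrmP f; last exact: h.
move=> _; have [hz cj] := h _ _ fj; apply: (@below_mono _ _ None) => //.
by split=> //; apply: le_trans cj (inj_bot _ _ hz).
Qed.

(** Soundness of the upper bounds in [C]; together with [above_dn] it turns an instance of the leaf
    rule into an inequality between values. *)
Lemma below_up p i b : le (up leafE p i) (Some b) -> below (eval p) i b.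
Proof.
elim: p i b => [j a|p IHp q IHq|p IHp q IHq].
- apply: below_nrm => i b; case: eqP => //= -> ab.
  by apply: (@below_mono _ _ (Some a) _ _ ab) => /=.
- apply: (below_nrm (f := fun i => meet (up leafE p i) (up leafE q i))) => i b.
  rewrite [eval _]/=; case Ep : (up leafE p i) => [bp|]; case Eq : (up leafE q i) => [bq|] //.
  + have hp : below (eval p) i bp by apply: IHp; rewrite Ep; exact: (@le_refl T).
    have hq : below (eval q) i bq by apply: IHq; rewrite Eq; exact: (@le_refl T).
    move=> h; have {}h : le (meet bp bq) b := h; apply: (below_mono _ h) => {h}.
    case: bp bq hp hq {Ep Eq} => [a|] [a'|] /=.
    * by move=> h1 h2; apply: le_trans (inj_meet _ _ _); exact: le_meet.
    * by move=> _ [hz h]; split=> //; apply: le_trans h.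
    * by move=> [hz h] _; split=> //; apply: le_trans h.
    * by move=> [hz h] _; split=> //; apply: le_trans h.
  + move=> h; have : below (eval p) i b by apply: IHp; rewrite Ep.
    by case: b {h} => [a|] /= h; [|case: h => hz h; split=> //]; apply: le_trans h.
  + move=> h; have : below (eval q) i b by apply: IHq; rewrite Eq.
    by case: b {h} => [a|] /= h; [|case: h => hz h; split=> //]; apply: le_trans h.
- move=> i b h.
  have hp : below (eval p) i b by apply: IHp; apply: le_trans h; exact: join_l.
  have hq : below (eval q) i b by apply: IHq; apply: le_trans h; exact: join_r.
  case: b {h} hp hq => [a|] /=; first exact: join_lub.
  by move=> [hz h1] [_ h2]; split=> //; exact: join_lub.
Qed.

Lemma above_dn p i : above i (dn leafE p i) (eval p).
Proof.
have bot_eval (q : term E) : z -> le (inj i bot) (eval q).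
  move=> hz; elim: q => [j a|q1 h1 q2 h2|q1 h1 q2 h2] /=.
  - by apply: le_trans (inj_bot i j hz) (inj_mono _ (bot_le _)).
  - exact: meet_glb.
  - exact: le_trans (join_l _ _).
elim: p => [j a|p IHp q IHq|p IHp q IHq].
- by rewrite /=; have [->|_] := eqVneq i j; [exact: le_refl|exact: (bot_eval (Leaf j a))].
- rewrite [dn _ _]/=; case: (dn leafE p i) IHp => [a|]; case: (dn leafE q i) IHq => [b|];
    try (by move=> *; exact: (bot_eval (Meet p q))).
  by move=> /= h2 h1; apply: meet_glb; [apply: le_trans h1|apply: le_trans h2]; exact: inj_mono.
- rewrite [dn _ _]/=; case: (dn leafE p i) IHp => [a|]; case: (dn leafE q i) IHq => [b|].
  + by move=> /= h2 h1; apply: le_trans (inj_join _ _ _) _; exact: le_join.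
  + by move=> _ /= h; apply: le_trans h _; exact: join_l.
  + by move=> /= h _; apply: le_trans h _; exact: join_r.
  + by move=> _ _; exact: (bot_eval (Join p q)).
Qed.

(* The rules of [W] are finitely many and each of them can be defeated by a suitable approximant;
   as approximants are directed, one of them defeats all the rules. *)
Lemma eval_sep p q : ~ le (eval p) (eval q) ->
  ev p (fun p' => forall q', approx q' q -> ~ W leafX p' q').
Proof.
have [n] : exists n, (term_size p + term_size q < n)%nat by eexists.
elim: n p q => [|n IH] p q; first by lia.
move=> sz npq.
have leaf i : ev p (fun p' => forall q', approx q' q ->
    ~ le (up leafX p' i) (Some (dn leafX q' i))).
  (* By [up_cont], [t] stays below [up] of large approximants of [p], whereas approximants of [q]
     only have a smaller [dn]. *)
  have [t [tt tp] ntq] : exists2 t, test t /\ le t (up leafE p i) &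
      ~ le t (Some (dn leafE q i)).
    apply: contrapT => nt; apply: npq.
    have pq : le (up leafE p i) (Some (dn leafE q i)).
      apply: test_dense => t tt tp; apply: contrapT => ntq; apply: nt; by exists t.
    by apply: below_above (below_up pq) (le_refl _) (above_dn q i).
  apply: ev_imp (up_cont tt tp) => p' _ tp' q' aq h; apply: ntq.
  apply: le_trans tp' _; apply: le_trans h _; rewrite top_le_Some.
  exact: (leafwise_dn (R := fun x a => le (lam x) a)).
have left : ev p (fun p' => forall q', approx q' q -> ~ match p' with
    | Leaf _ _ => False
    | Join p1 p2 => W leafX p1 q' /\ W leafX p2 q'
    | Meet p1 p2 => W leafX p1 q' \/ W leafX p2 q'
    end).
  case: p sz npq {leaf} => [i a|p1 p2|p1 p2] sz npq; simpl in sz.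
  - by apply: ev_all => -[i' x|//|//] _ q' _.
  - have e1 : ev p1 (fun p' => forall q', approx q' q -> ~ W leafX p' q').
      by apply: IH => [|h]; [lia|apply: npq; exact: le_trans (meet_l _ _) h].
    have e2 : ev p2 (fun p' => forall q', approx q' q -> ~ W leafX p' q').
      by apply: IH => [|h]; [lia|apply: npq; exact: le_trans (meet_r _ _) h].
    apply: ev_imp (ev_Meet e1 e2) => -[//|p1' p2' _ [h1 h2] q' aq []|//]; by [exact: h1|exact: h2].
  (* One of [p1], [p2] is not below [q], and its approximants alone block the rule. *)
  - have [h1|h1] := EM (le (eval p1) (eval q)).
      have e2 : ev p2 (fun p' => forall q', approx q' q -> ~ W leafX p' q').
        by apply: IH => [|h]; [lia|apply: npq; exact: join_lub].
      have e1 : ev p1 (fun=> True) by exact: ev_all.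
      by apply: ev_imp (ev_Join e1 e2) => -[//|//|p1' p2' _ [_ h2] q' aq [_]]; exact: h2.
    have e1 : ev p1 (fun p' => forall q', approx q' q -> ~ W leafX p' q') by apply: IH => //; lia.
    have e2 : ev p2 (fun=> True) by exact: ev_all.
    by apply: ev_imp (ev_Join e1 e2) => -[//|//|p1' p2' _ [h2 _] q' aq [+ _]]; exact: h2.
have right : ev p (fun p' => forall q', approx q' q -> ~ match q' with
    | Leaf _ _ => False
    | Join q1 q2 => W leafX p' q1 \/ W leafX p' q2
    | Meet q1 q2 => W leafX p' q1 /\ W leafX p' q2
    end).
  case: q sz npq {leaf left} => [i a|q1 q2|q1 q2] sz npq; simpl in sz.
  - by apply: ev_all => p' _ [i' x _ []|? ? []|? ? []].
  - have [h1|h1] := EM (le (eval p) (eval q1)).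
      have e2 : ev p (fun p' => forall q', approx q' q2 -> ~ W leafX p' q').
        by apply: IH => [|h]; [lia|apply: npq; exact: meet_glb].
      by apply: ev_imp e2 => p' _ h [//|q1' q2' [_ aq] [_]|//]; exact: h.
    have e1 : ev p (fun p' => forall q', approx q' q1 -> ~ W leafX p' q') by apply: IH => //; lia.
    by apply: ev_imp e1 => p' _ h [//|q1' q2' [aq _] [+ _]|//]; exact: h.
  - have e1 : ev p (fun p' => forall q', approx q' q1 -> ~ W leafX p' q').
      by apply: IH => [|h]; [lia|apply: npq; exact: le_trans h (join_l _ _)].
    have e2 : ev p (fun p' => forall q', approx q' q2 -> ~ W leafX p' q').
      by apply: IH => [|h]; [lia|apply: npq; exact: le_trans h (join_r _ _)].
    apply: ev_imp (ev_and e1 e2) => p' _ [h1 h2] [//|//|q1' q2' [a1 a2] []];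
      by [exact: h1|exact: h2].
apply: ev_imp (ev_and (ev_and (leaf true) (leaf false)) (ev_and left right)).
move=> p' _ [[ht hf] [hl hr]] q' aq /W_inv[[[] h]|[h|h]].
- exact: (ht _ aq).
- exact: (hf _ aq).
- exact: (hl _ aq).
- exact: (hr _ aq).
Qed.

Lemma eval_le p q :
  (forall p', approx p' p -> exists2 q', approx q' q & W leafX p' q') ->
  le (eval p) (eval q).
Proof.
move=> h; apply: contrapT => /eval_sep/ev_ex[p' ap np].
by have [q' aq /(np _ aq)] := h p' ap.
Qed.

End Evaluation.
End Approximation.

(** * The graph of labelled edges *)

Inductive link := L1 | L2 | L3 | L4.
Inductive inner := I1 | I2 | I3.

(* [Sub e a b k] is the [k]-th edge, and [Mid e a b k] the [k]-th inner vertex, of the path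
   [src e -a- I1 -b- I2 -a- I3 -b- tgt e]
   attached to the edge [e]. *)
Inductive edge (D : Type) : Type :=
| Spoke of D
| Sub of edge D & D & D & link.

Inductive vertex (D : Type) : Type :=
| Root
| Tip of D
| Mid of edge D & D & D & inner.
Arguments Root {D}.

Fixpoint src (D : Type) (e : edge D) : vertex D :=
  match e with
  | Spoke _ => Root
  | Sub e a b L1 => src e
  | Sub e a b L2 => Mid e a b I1
  | Sub e a b L3 => Mid e a b I2
  | Sub e a b L4 => Mid e a b I3
  end.

Fixpoint tgt (D : Type) (e : edge D) : vertex D :=
  match e with
  | Spoke t => Tip t
  | Sub e a b L1 => Mid e a b I1
  | Sub e a b L2 => Mid e a b I2
  | Sub e a b L3 => Mid e a b I3
  | Sub e a b L4 => tgt e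
  end.

Section Graph.
Variables (D : bprelattice) (filler : D).
Hypothesis filler_pos : ~ le filler bot.

(* A path that must not be attached because [l <= join a b] fails, or that would identify vertices
   because [a] or [b] is a bottom, is made harmless by relabelling its edges with [l]. *)
Definition splits (l a b : D) : Prop :=
  le l (join a b) /\ ~ le a bot /\ ~ le b bot.

Definition wt (l a b x : D) : D := if `[< splits l a b >] then x else l.

(** A spoke labelled by a bottom would be contracted at every [c]; the nonzero [filler] replaces
    such a label, so that no label is a bottom. *)
Fixpoint lab (e : edge D) : D :=
  match e with
  | Spoke t => if `[< le t bot >] then filler else t
  | Sub e a b (L1 | L3) => wt (lab e) a b a
  | Sub e a b (L2 | L4) => wt (lab e) a b b
  end.

Definition wtl e a b := wt (lab e) a b a.
Definition wtr e a b := wt (lab e) a b b.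

Lemma lab_pos e : ~ le (lab e) bot.
Proof.
elim: e => [t|e IH a b k] /=; first by case: asboolP.
by case: k; rewrite /wt; case: asboolP => // -[_ []].
Qed.

Lemma wtl_pos e a b : ~ le (wtl e a b) bot.
Proof. exact: (@lab_pos (Sub e a b L1)). Qed.

Lemma wtr_pos e a b : ~ le (wtr e a b) bot.
Proof. exact: (@lab_pos (Sub e a b L2)). Qed.

(** On a relabelled path both weights equal the label of [e]. If the whole path is contracted, so is
    [e]: attaching a path never identifies older vertices. *)
Lemma lab_join e a b : le (lab e) (join (wtl e a b) (wtr e a b)).
Proof. by rewrite /wtl /wtr /wt; case: asboolP => // -[]. Qed.

(** A contracted vertex moves to an end of [e] if it can, and otherwise to the first vertex of its
    block on the path. When both labels are below [c], so is that of [e], and the two ends have the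
    same representative. *)
Definition inner_rep c (e : edge D) (a b : D) (s t : vertex D) (k : inner) : vertex D :=
  match k, `[< le (wtl e a b) c >], `[< le (wtr e a b) c >] with
  | I1, true, _ => s
  | I1, false, _ => Mid e a b I1
  | I2, true, true => s
  | I2, false, true => Mid e a b I1
  | I2, _, false => Mid e a b I2
  | I3, _, true => t
  | I3, true, false => Mid e a b I2
  | I3, false, false => Mid e a b I3
  end.

(** The ends of [e] are not subterms of [Mid e a b k], so the recursion runs over edges and computes
    the representatives of both ends at once. *)
Fixpoint ends_rep c (e : edge D) : vertex D * vertex D :=
  match e with
  | Spoke t => (Root, if `[< le (lab (Spoke t)) c >] then Root else Tip t)
  | Sub e a b k =>
      let: (s, t) := ends_rep c e in
      match k with
      | L1 => (s, inner_rep c e a b s t I1)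
      | L2 => (inner_rep c e a b s t I1, inner_rep c e a b s t I2)
      | L3 => (inner_rep c e a b s t I2, inner_rep c e a b s t I3)
      | L4 => (inner_rep c e a b s t I3, t)
      end
  end.

(* The representative of the component of [v] in the graph of all edges labelled below [c]; with
   it, joinedness is an equivalence relation for free. *)
Definition rep c (v : vertex D) : vertex D :=
  match v with
  | Root => Root
  | Tip t => if `[< le (lab (Spoke t)) c >] then Root else Tip t
  | Mid e a b k => inner_rep c e a b (ends_rep c e).1 (ends_rep c e).2 k
  end.

Lemma ends_repE c e : ends_rep c e = (rep c (src e), rep c (tgt e)).
Proof.
elim: e => [t|e IH a b k] //=.
by case: k => /=; rewrite IH.
Qed.

Lemma rep_mid c e a b k :
  rep c (Mid e a b k) = inner_rep c e a b (rep c (src e)) (rep c (tgt e)) k.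
Proof. by rewrite /= ends_repE. Qed.

Lemma rep_edge c e : le (lab e) c -> rep c (src e) = rep c (tgt e).
Proof.
elim: e => [t|e IH a b k] h; first by rewrite /= asboolT.
case: k h => h; rewrite [src _]/= [tgt _]/= !rep_mid /inner_rep -?/(wtl e a b);
  have [hl|hl] := asboolP (le (wtl e a b) c);
  have [hr|hr] := asboolP (le (wtr e a b) c) => //.
apply: IH; apply: le_trans (lab_join e a b) _; exact: join_lub.
Qed.

Definition joined c (u v : vertex D) : Prop := rep c u = rep c v.

Lemma joined_equiv c : equivalence _ (joined c).
Proof. by split=> [u|u v w|u v]; rewrite /joined => // -> ->. Qed.

Section Generation.
Variables (c : D) (F : relation (vertex D)).
Hypothesis F_equiv : equivalence _ F.
Hypothesis F_edge : forall e, le (lab e) c -> F (src e) (tgt e).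

(** Each replacement made by [rep] follows edges labelled below [c]. With [rep_edge], this makes
    [joined c] the least equivalence relation containing these edges. *)
Lemma rep_connected v : F v (rep c v).
Proof.
have [Fr Ft Fs] := F_equiv.
have ends e : F (src e) (rep c (src e)) /\ F (tgt e) (rep c (tgt e)).
  elim: e => [t|e [IHs IHt] a b k].
    split; first exact: Fr.
    rewrite /=; case: asboolP => h; last exact: Fr.
    by apply: Fs; apply: (F_edge (e := Spoke t)).
  suff mid j : F (Mid e a b j) (rep c (Mid e a b j)) by case: k; split => //=; exact: mid.
  have := @F_edge (Sub e a b L1); have := @F_edge (Sub e a b L2).
  have := @F_edge (Sub e a b L3); have := @F_edge (Sub e a b L4).
  rewrite /= -/(wtl e a b) -/(wtr e a b) ends_repE /inner_rep /=.
  case: asboolP => hl; case: asboolP => hr e4 e3 e2 e1; case: j; auto.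
  - by apply: Ft (Fs _ _ (e1 _)) IHs.
  - by apply: Ft (Fs _ _ (e2 _)) (Ft _ _ _ (Fs _ _ (e1 _)) IHs).
  - exact: Ft (e4 _) IHt.
  - by apply: Ft (Fs _ _ (e1 _)) IHs.
  - exact: Ft (e4 _) IHt.
case: v => [|t|e a b k]; first exact: Fr.
  exact: (ends (Spoke t)).2.
case: k.
- exact: (ends (Sub e a b L1)).2.
- exact: (ends (Sub e a b L2)).2.
- exact: (ends (Sub e a b L3)).2.
Qed.

Lemma joined_sub u v : joined c u v -> F u v.
Proof.
have [Fr Ft Fs] := F_equiv; move=> uv; apply: Ft (rep_connected u) _.
by rewrite uv; apply: Fs; exact: rep_connected.
Qed.

End Generation.

Lemma joined_mono c c' u v : le c c' -> joined c u v -> joined c' u v.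
Proof.
move=> cc'; apply: joined_sub (joined_equiv c') _ _ _ => e h.
by apply: rep_edge; exact: le_trans cc'.
Qed.

Lemma rep_rep c c' v : le c c' -> rep c' (rep c v) = rep c' v.
Proof.
move=> cc'; apply: esym; apply: (@rep_connected c (joined c')) => [|e h].
  exact: joined_equiv.
by apply: rep_edge; exact: le_trans cc'.
Qed.

(** An edge labelled below [join c c'] carries a path labelled [c], [c'], [c], [c'] between its
    ends. *)
Lemma joined_join c c' (F : relation (vertex D)) : equivalence _ F ->
  (forall u v, joined c u v -> F u v) -> (forall u v, joined c' u v -> F u v) ->
  forall u v, joined (join c c') u v -> F u v.
Proof.
move=> FE Fc Fc'; apply: joined_sub => // e h; have [_ Ft _] := FE.
(* A path with a bottom parameter is relabelled, but then the label of [e] is already below the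
   other parameter. *)
have [cb|cb] := EM (le c bot).
  apply: Fc'; apply: rep_edge; apply: le_trans h _; apply: join_lub => //.
  exact: le_trans cb (bot_le _).
have [cb'|cb'] := EM (le c' bot).
  apply: Fc; apply: rep_edge; apply: le_trans h _; apply: join_lub => //.
  exact: le_trans cb' (bot_le _).
have sp : splits (lab e) c c' by [].
have h1 : joined c (src e) (Mid e c c' I1).
  by apply: (@rep_edge c (Sub e c c' L1)); rewrite /= /wt asboolT.
have h2 : joined c' (Mid e c c' I1) (Mid e c c' I2).
  by apply: (@rep_edge c' (Sub e c c' L2)); rewrite /= /wt asboolT.
have h3 : joined c (Mid e c c' I2) (Mid e c c' I3).
  by apply: (@rep_edge c (Sub e c c' L3)); rewrite /= /wt asboolT.
have h4 : joined c' (Mid e c c' I3) (tgt e).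
  by apply: (@rep_edge c' (Sub e c c' L4)); rewrite /= /wt asboolT.
exact: Ft (Fc _ _ h1) (Ft _ _ _ (Fc' _ _ h2) (Ft _ _ _ (Fc _ _ h3) (Fc' _ _ h4))).
Qed.

Lemma joined_bot c u v : le c bot -> joined c u v -> u = v.
Proof.
move=> cb; suff id w : rep c w = w by rewrite /joined !id.
case: w => [//|t|e a b k] /=.
  by case: asboolP => // h; case: (@lab_pos (Spoke t)); exact: le_trans h cb.
rewrite /inner_rep !asboolF; first by case: k.
- by move=> h; case: (@wtr_pos e a b); exact: le_trans h cb.
- by move=> h; case: (@wtl_pos e a b); exact: le_trans h cb.
Qed.

(** The spokes make the representation faithful: whether [t] is below [c] can be read off from its
    tip. *)
Lemma joined_tip c t : joined c Root (Tip t) -> le t c.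
Proof.
rewrite /joined /=; case: (asboolP (le t bot)) => [tb _|_].
  exact: le_trans tb (bot_le _).
by case: asboolP.
Qed.

Lemma tip_joined c t : ~ le t bot -> le t c -> joined c Root (Tip t).
Proof. by move=> nt tc; rewrite /joined /= (asboolF nt) asboolT. Qed.

Lemma edges_connected (F : relation (vertex D)) : equivalence _ F ->
  (forall e, F (src e) (tgt e)) -> forall u v, F u v.
Proof.
move=> [Fr Ft Fs] Fe; suff h u : F u Root by move=> u v; apply: Ft (h u) (Fs _ _ (h v)).
have ends e : F (src e) Root.
  elim: e => [t|e IH a b k]; first exact: Fr.
  have h1 : F (src (Sub e a b L2)) Root by apply: Ft (Fs _ _ (Fe (Sub e a b L1))) IH.
  have h2 : F (src (Sub e a b L3)) Root by apply: Ft (Fs _ _ (Fe (Sub e a b L2))) h1.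
  case: k => //; exact: Ft (Fs _ _ (Fe (Sub e a b L3))) h2.
case: u => [|t|e a b k]; first exact: Fr.
  exact: Fs (Fe (Spoke t)).
by case: k; [exact: ends (Sub e a b L2)|exact: ends (Sub e a b L3)|exact: ends (Sub e a b L4)].
Qed.

(** * Heights of vertices and compatibility with meets *)

Fixpoint edge_height (e : edge D) : nat :=
  match e with Spoke _ => 1 | Sub e _ _ _ => S (edge_height e) end.

Definition height (v : vertex D) : nat :=
  match v with Root => 0 | Tip _ => 1 | Mid e _ _ _ => S (edge_height e) end.

(** The vertices that [rep c] moves to a smaller height: tips to the root, inner vertices off their
    path. [I2] needs both labels, since with only one it stays among the inner vertices. *)
Definition low c (v : vertex D) : Prop :=
  match v with
  | Root => False
  | Tip t => le (lab (Spoke t)) c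
  | Mid e a b I1 => le (wtl e a b) c
  | Mid e a b I2 => le (wtl e a b) c /\ le (wtr e a b) c
  | Mid e a b I3 => le (wtr e a b) c
  end.

Definition family (v : vertex D) : vertex D :=
  match v with Mid e a b _ => Mid e a b I1 | v => v end.

Lemma height_family v : height (family v) = height v.
Proof. by case: v. Qed.

Lemma rep_ends_height c e :
  (height (rep c (src e)) <= edge_height e)%nat /\ (height (rep c (tgt e)) <= edge_height e)%nat.
Proof.
elim: e => [t|e [IHs IHt] a b k].
  by rewrite /=; case: asboolP => _ /=; lia.
suff mid j : (height (rep c (Mid e a b j)) <= S (edge_height e))%nat.
  case: k; rewrite [src _]/= [tgt _]/= [edge_height _]/=;
    have := mid I1; have := mid I2; have := mid I3; lia.
rewrite rep_mid /inner_rep; move: (rep c (src e)) (rep c (tgt e)) IHs IHt => s t.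
by case: asboolP => _; case: asboolP => _; case: j => /=; lia.
Qed.

Lemma rep_low c v : low c v -> (height (rep c v) < height v)%nat.
Proof.
case: v => [//|t|e a b k]; first by move=> h; rewrite /rep (asboolT h) /=; lia.
have [hs ht] := rep_ends_height c e.
case: k; rewrite rep_mid [low _ _]/= [height (Mid _ _ _ _)]/= /inner_rep.
- by move=> h; rewrite (asboolT h); lia.
- by move=> [h h']; rewrite (asboolT h) (asboolT h'); lia.
- by move=> h; rewrite (asboolT h); case: asboolP => _; lia.
Qed.

Lemma rep_high c v : ~ low c v -> family (rep c v) = family v.
Proof.
case: v => [//|t|e a b k]; first by rewrite /low /rep => h; rewrite (asboolF h).
case: k; rewrite rep_mid [low _ _]/= /inner_rep;
  have [hl|hl] := asboolP (le (wtl e a b) c);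
  have [hr|hr] := asboolP (le (wtr e a b) c) => // -[] //.
Qed.

Lemma low_meet c c' v : low c v -> low c' v -> low (meet c c') v.
Proof.
case: v => [//|t|e a b [] /=]; try exact: meet_glb.
by move=> [? ?] [? ?]; split; exact: meet_glb.
Qed.

Lemma fixed_high c v : rep c v = v -> ~ low c v.
Proof. by move=> cv /rep_low; rewrite cv; lia. Qed.

(** If the label were not below [c], one representative would be an inner vertex of the path, and
    the other a different one or the representative of an end of [e], which has smaller height. The
    next two lemmas hold for the same reason. *)
Lemma joined_mid12 c e a b : joined c (Mid e a b I1) (Mid e a b I2) -> le (wtr e a b) c.
Proof.
have [hs _] := rep_ends_height c e; rewrite /joined !rep_mid /inner_rep.
have [hl|hl] := asboolP (le (wtl e a b) c);
  have [hr|hr] := asboolP (le (wtr e a b) c) => // h; exfalso; move: h => // h.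
by move: hs; rewrite h /=; lia.
Qed.

Lemma joined_mid23 c e a b : joined c (Mid e a b I2) (Mid e a b I3) -> le (wtl e a b) c.
Proof.
have [_ ht] := rep_ends_height c e; rewrite /joined !rep_mid /inner_rep.
have [hl|hl] := asboolP (le (wtl e a b) c);
  have [hr|hr] := asboolP (le (wtr e a b) c) => // h.
by exfalso; move: ht; rewrite -h /=; lia.
Qed.

Lemma joined_mid13 c e a b : joined c (Mid e a b I1) (Mid e a b I3) -> le (wtr e a b) c.
Proof.
have [hs ht] := rep_ends_height c e; rewrite /joined !rep_mid /inner_rep.
have [hl|hl] := asboolP (le (wtl e a b) c);
  have [hr|hr] := asboolP (le (wtr e a b) c) => // h; exfalso.
by move: hs; rewrite h /=; lia.
Qed.

(** Compatibility with meets, reduced to representatives. Comparing heights puts both vertices on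
    one path, and there the labels decide. *)
Lemma fixed_separated c c' s t :
  rep (meet c c') s = s -> rep (meet c c') t = t ->
  joined c s t -> joined c' s t -> s = t.
Proof.
move=> ms mt cst c'st.
have fam : family s = family t.
  have [high_s high_t] := (fixed_high ms, fixed_high mt).
  (* The higher vertex [u] stays on its path for one of [c], [c'], called [d]; if [v] moved down at
     [d], the common representative would be too low. *)
  have core u v : (height v <= height u)%nat -> ~ low (meet c c') u ->
      joined c u v -> joined c' u v -> family u = family v.
    move=> uv nu cuv c'uv; have [d [du duv]] : exists d, ~ low d u /\ joined d u v.
      have [lu|nlu] := EM (low c u); last by exists c.
      by exists c'; split=> // lu'; apply: nu; exact: low_meet.
    have fu := rep_high du; rewrite duv in fu.
    have [lv|/rep_high <-//] := EM (low d v).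
    by have := rep_low lv; rewrite -(height_family (rep d v)) fu height_family; lia.
  have [st|st] : (height t <= height s)%nat \/ (height s <= height t)%nat by lia.
    exact: core.
  by apply: esym; apply: core => //; apply: esym.
case: s t ms mt cst c'st fam => [|t|e a b j] [|t'|e' a' b' j'] // ms mt cst c'st.
move=> /= [ee ea eb]; subst e' a' b'.
(* A vertex fixed at the meet keeps certain labels from being below the meet, whereas being joined
   at both [c] and [c'] puts one of them there. *)
have fix2 : rep (meet c c') (Mid e a b I2) = Mid e a b I2 -> ~ le (wtr e a b) (meet c c').
  by rewrite rep_mid /inner_rep => + h; rewrite (asboolT h); case: asboolP => // hl /esym E;
    have [hs _] := rep_ends_height (meet c c') e; move: hs; rewrite -E /=; lia.
have fix3 : rep (meet c c') (Mid e a b I3) = Mid e a b I3 ->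
    ~ le (wtr e a b) (meet c c') /\ ~ le (wtl e a b) (meet c c').
  rewrite rep_mid /inner_rep; have [_ ht] := rep_ends_height (meet c c') e.
  have [hl|hl] := asboolP (le (wtl e a b) (meet c c'));
    have [hr|hr] := asboolP (le (wtr e a b) (meet c c')) => // E; move: ht; rewrite E /=; lia.
case: j j' ms mt cst c'st => [] [] // ms mt cst c'st; exfalso.
- by apply: (fix2 mt); apply: meet_glb; apply: joined_mid12.
- by apply: (fix3 mt).1; apply: meet_glb; apply: joined_mid13.
- by apply: (fix2 ms); apply: meet_glb; apply: joined_mid12; apply: esym.
- by apply: (fix3 mt).2; apply: meet_glb; apply: joined_mid23.
- by apply: (fix3 ms).1; apply: meet_glb; apply: joined_mid13; apply: esym.
- by apply: (fix3 ms).2; apply: meet_glb; apply: joined_mid23; apply: esym.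
Qed.

Lemma joined_meet c c' u v : joined c u v -> joined c' u v -> joined (meet c c') u v.
Proof.
move=> cuv c'uv; apply: (@fixed_separated c c'); rewrite ?rep_rep //;
  by rewrite /joined !rep_rep.
Qed.

End Graph.

(** * Finitely supported equivalence relations *)

(** A common code for lists, terms, edges and vertices; the number at a fork can record a
    constructor. *)
Inductive tree (T : Type) : Type :=
| Bud of T
| Fork of nat & tree T & tree T.

(** * Cardinalities of lists, terms, edges and vertices *)

Section Cardinality.
Variable T : Type.
Hypothesis T_inf : infinite T.

Lemma tree_embeds : embeds (tree T) T.
Proof.
have [g gi] := infinite_nat_embeds T_inf.
have [pr pri] := infinite_square_embeds T_inf.
pose code := fix code t := match t with
  | Bud x => pr (g 0, x)
  | Fork n s t => pr (g (S n), pr (code s, code t)) end.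
exists code; elim=> [x|n s IHs t IHt] [y|m s' t'] /= /pri[].
- by move=> ->.
- by move/gi.
- by move/gi.
- by move=> /gi[->] /pri[/IHs-> /IHt->].
Qed.

Lemma inhabitant : T.
Proof.
apply: (projT1 (cid (P := fun=> True) _)).
by have [g _] := infinite_nat_embeds T_inf; exists (g 0).
Qed.

Lemma pair_embeds A B : embeds A T -> embeds B T -> embeds (A * B) T.
Proof.
move=> [f fi] [g gi]; have [pr pri] := infinite_square_embeds T_inf.
by exists (fun p => pr (f p.1, g p.2)) => -[a b] [a' b'] /= /pri[/fi-> /gi->].
Qed.

Lemma list_embeds A : embeds A T -> embeds (list A) T.
Proof.
move=> [f fi]; apply: embeds_trans tree_embeds.
exists (fix code l := match l with
  | nil => Bud inhabitant
  | a :: l => Fork 0 (Bud (f a)) (code l) end).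
by elim=> [|a l IH] [|b l'] //= [/fi-> /IH->].
Qed.

Lemma term_embeds X : embeds X T -> embeds (term X) T.
Proof.
move=> [f fi]; apply: embeds_trans tree_embeds.
exists (fix code p := match p with
  | Leaf true x => Fork 0 (Bud (f x)) (Bud inhabitant)
  | Leaf false x => Fork 1 (Bud (f x)) (Bud inhabitant)
  | Meet p q => Fork 2 (code p) (code q)
  | Join p q => Fork 3 (code p) (code q) end).
elim=> [[] x|p IHp q IHq|p IHp q IHq] [[] y|p' q'|p' q'] //=.
- by move=> [/fi->].
- by move=> [/fi->].
- by move=> [/IHp-> /IHq->].
- by move=> [/IHp-> /IHq->].
Qed.

Lemma edge_embeds X : embeds X T -> embeds (edge X) T.
Proof.
move=> [f fi]; apply: embeds_trans tree_embeds.
pose num k := match k with L1 => 1 | L2 => 2 | L3 => 3 | L4 => 4 end.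
exists (fix code e := match e with
  | Spoke t => Fork 0 (Bud (f t)) (Bud inhabitant)
  | Sub e a b k => Fork (num k) (code e) (Fork 0 (Bud (f a)) (Bud (f b))) end).
elim=> [t|e IH a b k] [t'|e' a' b' k'] //=.
- by move=> [/fi->].
- by move=> [nk /IH-> /fi-> /fi->]; case: k k' nk => [] [].
Qed.

Lemma vertex_embeds X : embeds X T -> embeds (vertex X) T.
Proof.
move=> XT; have [f fi] := XT; have [g gi] := edge_embeds XT.
apply: embeds_trans tree_embeds.
pose num k := match k with I1 => 1 | I2 => 2 | I3 => 3 end.
exists (fun v => match v with
  | Root => Bud inhabitant
  | Tip t => Fork 0 (Bud (f t)) (Bud inhabitant)
  | Mid e a b k => Fork (num k) (Bud (g e)) (Fork 0 (Bud (f a)) (Bud (f b))) end).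
move=> [|t|e a b k] [|t'|e' a' b' k'] //=.
- by move=> [/fi->].
- by move=> [nk /gi-> /fi-> /fi->]; case: k k' nk => [] [].
Qed.

End Cardinality.

(** * Equivalence relations as an algebraic lattice *)

Section EqLattice.
Variable T : Type.
Implicit Types R S : EqRel T.

Definition eq_le R S : Prop := forall x y, proj1_sig R x y -> proj1_sig S x y.

Lemma eq_le_antisym R S : eq_le R S -> eq_le S R -> R = S.
Proof.
case: R S => [R RE] [S SE] RS SR; apply: eq_exist.
by apply: funext => x; apply: funext => y; apply: propext; split; [exact: RS|exact: SR].
Qed.

Lemma eq_joinP R S U : eq_le R U -> eq_le S U -> eq_le (eq_join R S) U.
Proof. by move=> RU SU x y; apply => //; exact: (proj2_sig U). Qed.

Definition eq_pre : prelattice.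
Proof.
apply: (@PreLattice (EqRel T) eq_le (@eq_meet T) (@eq_join T)).
- by move=> R x y.
- by move=> S R U RS SU x y Rxy; exact: SU (RS _ _ Rxy).
- by move=> R S x y [].
- by move=> R S x y [].
- by move=> R S U UR US x y Uxy; split; [exact: UR|exact: US].
- by move=> R S x y Rxy E _ RE _; exact: RE.
- by move=> R S x y Sxy E _ _ SE; exact: SE.
- exact: eq_joinP.
Defined.

Definition eq_bpre : bprelattice.
Proof.
apply: (@BPreLattice eq_pre (eq_bot T)) => -[R [Rr _ _]] x _ /= <-; exact: Rr.
Defined.

Definition finitary R : Prop :=
  exists s : list T, forall x y, proj1_sig R x y -> x = y \/ (In x s /\ In y s).

Definition block_rel (s : list T) (x y : T) : Prop := x = y \/ (In x s /\ In y s).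

Lemma block_equiv s : equivalence T (block_rel s).
Proof.
split=> [x|x y t|x y]; first by left.
- by move=> [->//|[xs ys]] [<-|[_ ts]]; right.
- by move=> [->|[xs ys]]; [left|right].
Qed.

Definition block s : EqRel T := exist _ _ (block_equiv s).

Lemma finitary_le R S : eq_le R S -> finitary S -> finitary R.
Proof. by move=> RS [s Ss]; exists s => x y /RS /Ss. Qed.

Lemma finitary_block s : finitary (block s).
Proof. by exists s. Qed.

Lemma finitary_join R S : finitary R -> finitary S -> finitary (eq_join R S).
Proof.
move=> [s Rs] [s' Ss']; apply: finitary_le (finitary_block (s ++ s')).
apply: eq_joinP => x y.
- by move=> /Rs[->|[xs ys]]; [left|right; split; apply/in_or_app; left].
- by move=> /Ss'[->|[xs ys]]; [left|right; split; apply/in_or_app; right].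
Qed.

Lemma pair_below R x y : proj1_sig R x y ->
  exists2 S, finitary S /\ eq_le S R & proj1_sig S x y.
Proof.
have [Rr Rt Rs] := proj2_sig R; move=> Rxy; exists (block (x :: y :: nil)).
  split; first exact: finitary_block.
  move=> u v /= [->|[[<-|[<-|[]]] [<-|[<-|[]]]]];
    by [exact: Rr|exact: Rxy|exact: (Rs _ _ Rxy)].
by right; split; [left|right; left].
Qed.

(** The pairs joined by finitary parts of [R] and [S] form an equivalence relation containing both,
    hence their join; the finitely many pairs in the support of [U] are then collected one at a
    time. *)
Lemma finitary_split R S U : finitary U -> eq_le U (eq_join R S) ->
  exists R' S', [/\ finitary R', eq_le R' R, finitary S', eq_le S' S & eq_le U (eq_join R' S')].
Proof.
move=> [s Us] Ule.
pose covered x y := exists R' S',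
  [/\ finitary R', eq_le R' R, finitary S', eq_le S' S & proj1_sig (eq_join R' S') x y].
have dir R1 S1 R2 S2 : eq_le R1 R2 -> eq_le S1 S2 -> eq_le (eq_join R1 S1) (eq_join R2 S2).
  exact: (@le_join eq_pre).
have covE : equivalence T covered.
  split=> [x|x y t|x y].
  - exists (eq_bot T), (eq_bot T); split; try exact: (@bot_le eq_bpre);
      try by exists nil => ? ? ->; left.
  - move=> [R1 [S1 [fR1 R1R fS1 S1S h1]]] [R2 [S2 [fR2 R2R fS2 S2S h2]]].
    exists (eq_join R1 R2), (eq_join S1 S2); split; try exact: finitary_join; try exact: eq_joinP.
    have [_ tr _] := proj2_sig (eq_join (eq_join R1 R2) (eq_join S1 S2)).
    by apply: (tr _ y); [move: h1|move: h2]; apply: dir;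
      (exact: (@join_l eq_pre) || exact: (@join_r eq_pre)).
  - move=> [R1 [S1 [fR1 R1R fS1 S1S h1]]]; exists R1, S1; split=> //.
    by have [_ _ sy] := proj2_sig (eq_join R1 S1); exact: sy.
have cov x y : proj1_sig U x y -> covered x y.
  move=> /Ule; apply=> // {}x {}y xy.
  - have [R' [fR' R'R] R'xy] := pair_below xy.
    exists R', (eq_bot T); split=> //; try exact: (@bot_le eq_bpre).
      by exists nil => ? ? ->; left.
    by move=> E _ /(_ _ _ R'xy).
  - have [S' [fS' S'S] S'xy] := pair_below xy.
    exists (eq_bot T), S'; split=> //; try exact: (@bot_le eq_bpre).
      by exists nil => ? ? ->; left.
    by move=> E _ _ /(_ _ _ S'xy).
have [R' [S' [fR' R'R fS' S'S h]]] : exists R' S',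
    [/\ finitary R', eq_le R' R, finitary S', eq_le S' S &
     forall p, In p (list_prod s s) -> proj1_sig U p.1 p.2 -> proj1_sig (eq_join R' S') p.1 p.2].
  elim: (list_prod s s) => [|[x y] l [R1 [S1 [fR1 R1R fS1 S1S h1]]]].
    exists (eq_bot T), (eq_bot T); split; try exact: (@bot_le eq_bpre) => //;
      try by exists nil => ? ? ->; left.
    by [].
  have [Uxy|nUxy] := EM (proj1_sig U x y); last first.
    by exists R1, S1; split=> // p [<- //|]; exact: h1.
  have [R2 [S2 [fR2 R2R fS2 S2S h2]]] := cov _ _ Uxy.
  exists (eq_join R1 R2), (eq_join S1 S2); split; try exact: finitary_join; try exact: eq_joinP.
  move=> p [<- _|pl Up].
    by move: h2; apply: dir; exact: (@join_r eq_pre).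
  by move: (h1 p pl Up); apply: dir; exact: (@join_l eq_pre).
exists R', S'; split=> // x y Uxy; have [->|[xs ys]] := Us _ _ Uxy.
  by have [r _ _] := proj2_sig (eq_join R' S'); exact: r.
by apply: (h (x, y)) => //; apply/in_prod_iff.
Qed.

Definition fin_eq := {R : EqRel T | finitary R}.
Definition fin_val (F : fin_eq) : EqRel T := proj1_sig F.

Lemma fin_basis : @is_basis eq_bpre fin_eq fin_val.
Proof.
split.
- have fb : finitary (eq_bot T) by exists nil => ? ? ->; left.
  by exists (exist _ _ fb).
- move=> [R fR] [S fS]; exists (exist _ _ (finitary_join fR fS)) => /=.
  by split; [exact: (@join_l eq_pre)|split; [exact: (@join_r eq_pre)|]].
- move=> [R fR] [S fS].
  have fRS : finitary (eq_meet R S) by apply: finitary_le fR; exact: (@meet_l eq_pre).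
  exists (exist _ _ fRS) => /=.
  by split; [|split; [exact: (@meet_l eq_pre)|exact: (@meet_r eq_pre)]].
- move=> [U fU] R S /= /(finitary_split fU)[R' [S' [fR' R'R fS' S'S h]]].
  by exists (exist _ _ fR'), (exist _ _ fS').
- move=> R S h x y /pair_below[F [fF FR] Fxy].
  by apply: (h (exist _ _ fF)).
Qed.

Lemma fin_eq_embeds : infinite T -> embeds fin_eq T.
Proof.
move=> Tinf; apply: embeds_trans (list_embeds Tinf (pair_embeds Tinf _ _));
  try by exists id.
have /choice[f fP] : forall F : fin_eq, exists l : list (T * T),
    forall x y, proj1_sig (fin_val F) x y <-> x = y \/ In (x, y) l.
  move=> [R [s Rs]] /=.
  exists (List.filter (fun p => `[< proj1_sig R p.1 p.2 >]) (list_prod s s)) => x y.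
  split=> [Rxy|[->|/filter_In[_ /asboolP]//]].
    have [|[xs ys]] := Rs _ _ Rxy; [by left|right; apply/filter_In].
    by split; [apply/in_prod_iff|apply/asboolP].
  by have [r _ _] := proj2_sig R; exact: r.
exists f => F G fFG; have e : fin_val F = fin_val G.
  by apply: eq_le_antisym => x y /fP; [rewrite fFG|rewrite -fFG] => /fP.
by case: F G e {fFG} => [F fF] [G fG] /= e; subst G; congr exist; exact: Prop_irrelevance.
Qed.

(** The point [x] is recovered from the block of [o] and [x], which is the identity relation for
    [x = o]. *)
Lemma embeds_fin_eq (o : T) : embeds T fin_eq.
Proof.
exists (fun x => exist _ (block (o :: x :: nil)) (finitary_block _)) => x y [] e.
have : block_rel (o :: x :: nil) o x by right; split; [left|right; left].
rewrite e => -[xo|[_ [xo|[//|[]]]]]; subst.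
  have : block_rel (x :: y :: nil) x y by right; split; [left|right; left].
  by rewrite -e => -[//|[_ [|[|[]]]]].
have : block_rel (x :: y :: nil) x y by right; split; [left|right; left].
by rewrite -e => -[//|[_ [|[|[]]]]].
Qed.

End EqLattice.

(** * The representation *)

Section TermLattice.
Variables (z : Prop) (E : bprelattice) (X : Type) (lam : X -> E).
Notation leafX := (leafX z lam).

Definition term_pre : prelattice.
Proof.
apply: (@PreLattice (term X) (W leafX) (@Meet X) (@Join X)).
- exact: W_refl.
- by move=> q p r; exact: W_trans.
- by move=> p q; apply: W_meetl1; exact: W_refl.
- by move=> p q; apply: W_meetl2; exact: W_refl.
- by move=> p q r; exact: W_meetr.
- by move=> p q; apply: W_joinr1; exact: W_refl.
- by move=> p q; apply: W_joinr2; exact: W_refl.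
- by move=> p q r; exact: W_joinl.
Defined.

Variable x0 : X.
Hypothesis x0_bot : le (lam x0) bot.

Definition term_bpre : bprelattice.
Proof.
(* The two copies need not share their bottom, so the bottom of the coproduct is the meet of
   both. *)
apply: (@BPreLattice term_pre (Meet (Leaf true x0) (Leaf false x0))) => p /=.
elim: p => [i x|p IHp q IHq|p IHp q IHq].
- have h j : W leafX (Leaf j x0) (Leaf j x).
    by apply: leafwise_W; split=> //; exact: le_trans x0_bot (bot_le _).
  by case: i; [apply: W_meetl1|apply: W_meetl2].
- exact: W_meetr.
- exact: W_joinr1.
Defined.

Lemma leaf_bot i x : z -> le (lam x) bot -> @le term_bpre (Leaf i x) bot.
Proof.
move=> hz xb; suff h j : W leafX (Leaf i x) (Leaf j x0) by apply: W_meetr.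
apply: (W_leaf (i := i)); apply: le_trans (nrm_le _ _) _.
rewrite eqxx top_le_Some /=; case: eqP => _ //=.
exact: le_trans xb (bot_le _).
Qed.

Lemma leaf_pos i x : ~ le (lam x) bot -> ~ @le term_bpre (Leaf i x) bot.
Proof.
move=> nx /W_mono[_ /(_ i)] /=; rewrite eqxx => h; apply: nx.
by move: h; case: i => /= -[].
Qed.

Lemma leaf_meet i x y w : le (meet (lam x) (lam y)) (lam w) ->
  W leafX (Meet (Leaf i x) (Leaf i y)) (Leaf i w).
Proof.
move=> h; apply: (W_leaf (i := i)).
apply: le_trans (nrm_le _ _) _; apply: le_trans (le_meet (nrm_le _ _) (nrm_le _ _)) _.
by rewrite /= eqxx.
Qed.

Lemma leaf_join i x y w : le (lam w) (join (lam x) (lam y)) ->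
  W leafX (Leaf i w) (Join (Leaf i x) (Leaf i y)).
Proof.
move=> h; apply: (W_leaf (i := i)); apply: le_trans (nrm_le _ _) _.
by rewrite /= eqxx.
Qed.

End TermLattice.

Section Representation.
Variables (z : Prop) (E : bprelattice) (X : Type) (lam : X -> E).
Hypothesis lamP : is_basis lam.
Variables (x0 x1 : X).
Hypothesis x0_bot : le (lam x0) bot.
Hypothesis x1_pos : ~ le (lam x1) bot.

Notation leafX := (leafX z lam).
Notation D := (term_bpre z x0_bot).
Notation app := (approx lam).
Definition tfiller : D := Leaf true x1.
Notation joined := (@joined D tfiller).

Lemma tfiller_pos : ~ @le D tfiller bot.
Proof. exact: leaf_pos. Qed.

(** The ideal of [D] generated by the approximants of [p] acts by the directed union of their
    relations. *)
Definition conn (p : term E) : relation (vertex D) :=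
  fun u v => exists2 p', app p' p & joined p' u v.

Lemma conn_equiv p : equivalence _ (conn p).
Proof.
split.
- by move=> u; have [p' ap] := approx_ex lamP p; exists p'.
- move=> u v w [p1 a1 h1] [p2 a2 h2]; have [p3 a3 [t1 t2]] := approx_dir lamP a1 a2.
  exists p3 => //; have [_ tr _] := @joined_equiv D tfiller p3; apply: (tr _ v).
    by apply: joined_mono h1; exact: leafwise_W.
  by apply: joined_mono h2; exact: leafwise_W.
- by move=> u v [p' ap h]; exists p'.
Qed.

Lemma conn_Meet p q u v : conn (Meet p q) u v <-> conn p u v /\ conn q u v.
Proof.
split=> [[[//|p' q' [ap aq] h|//]]|[[p' ap hp] [q' aq hq]]].
  by split; [exists p'|exists q'] => //; apply: joined_mono h;
    [apply: W_meetl1|apply: W_meetl2]; exact: W_refl.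
by exists (Meet p' q') => //; exact: (@joined_meet D tfiller p' q').
Qed.

Lemma conn_Join p q u v : conn (Join p q) u v <->
  forall F, equivalence _ F -> (forall a b, conn p a b -> F a b) ->
    (forall a b, conn q a b -> F a b) -> F u v.
Proof.
split=> [[[//|//|p' q' [ap aq] h]] F FE Fp Fq|].
  apply: (@joined_join D tfiller p' q' F FE _ _ u v h) => a b hab.
    by apply: Fp; exists p'.
  by apply: Fq; exists q'.
apply; first exact: conn_equiv.
- move=> a b [p' ap h]; have [q' aq] := approx_ex lamP q; exists (Join p' q') => //.
  by apply: joined_mono h; apply: W_joinr1; exact: W_refl.
- move=> a b [q' aq h]; have [p' ap] := approx_ex lamP p; exists (Join p' q') => //.
  by apply: joined_mono h; apply: W_joinr2; exact: W_refl.
Qed.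

Lemma conn_leaf_meet i a b u v :
  conn (Leaf i (meet a b)) u v <-> conn (Meet (Leaf i a) (Leaf i b)) u v.
Proof.
split=> [[[j x [-> xab] h|//|//]]|[[//|p' q' [ap aq] h|//]]].
  apply/conn_Meet; split; exists (Leaf i x) => //; split=> //; exact: le_trans xab _.
case: p' q' ap aq h => [j x|? ?|? ?] [k y|? ?|? ?] // [-> xa] [-> yb] h.
have [w [xyw [wx wy]]] := basis_meet lamP x y.
exists (Leaf i w); last by apply: joined_mono h; exact: leaf_meet.
by split=> //; apply: meet_glb; [exact: le_trans wx _|exact: le_trans wy _].
Qed.

(** Compactness enters here: a compact element below [join a b] is below the join of compact
    elements below [a] and [b]. *)
Lemma conn_leaf_join i a b u v :
  conn (Leaf i (join a b)) u v <-> conn (Join (Leaf i a) (Leaf i b)) u v.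
Proof.
split=> [[[j x [-> xab] h|//|//]]|[[//|//|p' q' [ap aq] h]]].
  have [y [w [ya [wb xyw]]]] := basis_split lamP xab.
  exists (Join (Leaf i y) (Leaf i w)) => //.
  by apply: joined_mono h; exact: leaf_join.
case: p' q' ap aq h => [j x|? ?|? ?] [k y|? ?|? ?] // [-> xa] [-> yb] h.
have [w [xw [yw wxy]]] := basis_join lamP x y.
exists (Leaf i w); first by split=> //; apply: le_trans wxy _; exact: le_join.
by apply: joined_mono h; apply: W_joinl; apply: leafwise_W.
Qed.

Lemma conn_bot_leaf i u v : z -> conn (Leaf i bot) u v -> u = v.
Proof.
move=> hz [[j x [_ xb] h|//|//]]; apply: (joined_bot tfiller_pos _ h).
exact: leaf_bot.
Qed.

Lemma conn_bot u v : conn (Meet (Leaf true bot) (Leaf false bot)) u v -> u = v.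
Proof.
move=> [[//|p' q' [ap aq] h|//]].
case: p' q' ap aq h => [j x|? ?|? ?] [k y|? ?|? ?] // [-> xb] [-> yb] h.
apply: (joined_bot tfiller_pos _ h); apply: leafwise_W; split; split=> //.
  exact: le_trans xb _.
exact: le_trans yb _.
Qed.

Fixpoint tmap (t : term X) : term E :=
  match t with
  | Leaf i x => Leaf i (lam x)
  | Meet p q => Meet (tmap p) (tmap q)
  | Join p q => Join (tmap p) (tmap q)
  end.

Lemma approx_tmap t : app t (tmap t).
Proof. by elim: t => [i x|p IHp q IHq|p IHp q IHq]; split. Qed.

(** The label of an edge, read as a term over [E], has itself as an approximant, so its relation
    joins the ends of the edge; and the graph is connected. *)
Lemma conn_total (F : relation (vertex D)) : equivalence _ F ->
  (forall p u v, conn p u v -> F u v) -> forall u v, F u v.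
Proof.
move=> FE Fc; apply: edges_connected => // e.
apply: (Fc (tmap (lab tfiller e))); exists (lab tfiller e); first exact: approx_tmap.
exact: rep_edge.
Qed.

(** The relations are tested on the root and the tip of [p']; a bottom [p'], whose spoke carries the
    filler, is treated apart. *)
Lemma conn_reflects p q : (forall u v, conn p u v -> conn q u v) ->
  forall p', app p' p -> exists2 q', app q' q & W leafX p' q'.
Proof.
move=> pq p' ap; have [pb|pb] := EM (@le D p' bot).
  have [q' aq] := approx_ex lamP q; exists q' => //.
  exact: (@le_trans D _ _ _ pb (bot_le _)).
have [|q' aq h] := pq Root (Tip p'); first by exists p' => //; exact: tip_joined.
by exists q' => //; exact: joined_tip h.
Qed.

End Representation.

Section Main.
Variable T : Type.
Hypothesis T_inf : infinite T.
Variable z : Prop.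

Definition lattice_map (C : prelattice) (h : C -> EqRel T) : Prop :=
  (forall c d, h (meet c d) = eq_meet (h c) (h d)) /\
  (forall c d, h (join c d) = eq_join (h c) (h d)).

Lemma eq_rel_ext (R S : EqRel T) :
  (forall x y, proj1_sig R x y <-> proj1_sig S x y) -> R = S.
Proof. by move=> h; apply: eq_le_antisym => x y /h. Qed.

(** [h] is a map induced by [f] on a lattice [C] generated by two copies of the equivalence lattice.
    Since [C] is a preorder, the conditions on [inj] are inequalities and monotonicity of [h] is
    stated separately. *)
Definition recovers (f : bool -> EqRel T -> EqRel T) : Prop :=
  forall (C : prelattice) (inj : bool -> eq_bpre T -> C) (h : C -> EqRel T),
    (forall i a b, le a b -> le (inj i a) (inj i b)) ->
    (forall i a b, le (meet (inj i a) (inj i b)) (inj i (meet a b))) ->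
    (forall i a b, le (inj i (join a b)) (join (inj i a) (inj i b))) ->
    (forall i j, z -> le (inj i bot) (inj j bot)) ->
    lattice_map h -> (forall c d, le c d -> eq_le (h c) (h d)) ->
    (forall i a, h (inj i a) = f i a) ->
    (forall c, exists p, c = eval inj p) ->
    [/\ forall c d, eq_le (h c) (h d) -> le c d,
        forall b, (forall c, le b c) -> h b = eq_bot T &
        forall t, (forall c, le c t) -> h t = eq_top T].

Lemma coproduct_representation : exists f : bool -> EqRel T -> EqRel T,
  (forall i, @lattice_map (eq_pre T) (f i)) /\
  (z -> forall i, f i (eq_bot T) = eq_bot T) /\
  recovers f.
Proof.
have [o] : exists o : T, True by exists (inhabitant T_inf).
have [g gi] := infinite_nat_embeds T_inf => _.
have lamP := fin_basis T.
have [x0 x0b] := basis_bot lamP.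
pose x1 : fin_eq T := exist _ (block (g 0 :: g 1 :: nil)) (finitary_block _).
have x1p : ~ @le (eq_bpre T) (fin_val x1) bot.
  have h : proj1_sig (fin_val x1) (g 0) (g 1).
    by right; split; [left|right; left].
  by move=> /(_ _ _ h) /gi.
pose E := eq_bpre T; pose D := term_bpre z x0b.
(* There are as many vertices as points of [T], so the relations can be carried over from the graph
   to [T]. *)
have [b [b' [bK b'K]]] : exists (b : T -> vertex D) (b' : vertex D -> T),
    cancel b b' /\ cancel b' b.
  apply: embeds_antisym.
    have [k ki] := embeds_fin_eq o.
    by exists (fun x => Tip (Leaf true (k x) : D)) => x y [] /ki.
  by apply: vertex_embeds => //; apply: term_embeds => //; exact: fin_eq_embeds.
pose cn (p : term E) := @conn z E _ (@fin_val T) x0 x1 x0b p.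
have cnE p : equivalence T (fun x y => cn p (b x) (b y)).
  have [r t s] := @conn_equiv z E _ _ lamP x0 x1 x0b p.
  by split=> [x|x y w|x y]; [exact: r|exact: t|exact: s].
pose psi p : EqRel T := exist _ _ (cnE p).
have psi_Meet p q : psi (Meet p q) = eq_meet (psi p) (psi q).
  by apply: eq_rel_ext => x y; exact: conn_Meet.
have psi_Join p q : psi (Join p q) = eq_join (psi p) (psi q).
  apply: eq_rel_ext => x y; split.
    move=> /(conn_Join lamP) h F [Fr Ft Fs] Fp Fq.
    have := h (fun u v => F (b' u) (b' v)); rewrite !bK; apply.
    - by split=> [u|u v w|u v]; [exact: Fr|exact: Ft|exact: Fs].
    - by move=> u v h'; apply: Fp; rewrite /= !b'K.
    - by move=> u v h'; apply: Fq; rewrite /= !b'K.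
  move=> h; apply/(conn_Join lamP) => F [Fr Ft Fs] Fp Fq.
  apply: (h (fun x y => F (b x) (b y))) => [|u v|u v]; [|exact: Fp|exact: Fq].
  by split=> [u|u v w|u v]; [exact: Fr|exact: Ft|exact: Fs].
exists (fun i a => psi (Leaf i a)); split; [|split].
- split=> c d.
    by rewrite -psi_Meet; apply: eq_rel_ext => x y; exact: conn_leaf_meet.
  by rewrite -psi_Join; apply: eq_rel_ext => x y; exact: conn_leaf_join.
- move=> hz i; apply: eq_le_antisym; last exact: (@bot_le E).
  by move=> x y /= /(conn_bot_leaf x1p hz) /(can_inj bK).
move=> C inj h inj_mono inj_meet inj_join inj_bot [h_meet h_join] h_mono hinj gen.
have hE p : h (eval inj p) = psi p.
  by elim: p => [i a|p IHp q IHq|p IHp q IHq] /=; rewrite ?h_meet ?h_join ?IHp ?IHq.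
split.
- move=> c d; have [p ->] := gen c; have [q ->] := gen d; rewrite !hE => pq.
  apply: (eval_le lamP inj_mono inj_meet inj_join inj_bot).
  have : forall u v, cn p u v -> cn q u v.
    by move=> u v uv; have := pq (b' u) (b' v); rewrite /= !b'K; apply.
  exact: (@conn_reflects z E _ _ lamP x0 x1 x0b p q).
- move=> c0 c0_le; apply: eq_le_antisym; last exact: (@bot_le E).
  move=> x y /(h_mono _ _ (c0_le (eval inj (Meet (Leaf true bot) (Leaf false bot))))).
  by rewrite hE => /(conn_bot x1p) /(can_inj bK).
- move=> c1 c1_ge; apply: eq_le_antisym => // x y _.
  have [r t s] := proj2_sig (h c1).
  have := @conn_total z E _ (@fin_val T) x0 x1 x0b
    (fun u v => proj1_sig (h c1) (b' u) (b' v)) _ _ (b x) (b y).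
  rewrite !bK; apply.
    by split=> [u|u v w|u v]; [exact: r|exact: t|exact: s].
  move=> p u v uv; apply: (h_mono _ _ (c1_ge (eval inj p))).
  by rewrite hE /= !b'K.
Qed.
End Main.

(** * Embedding the coproducts *)

Section Dual.
Variables (C : Type) (m j : C -> C -> C).
Hypothesis C_lattice : is_lattice m j.

Lemma lattice_idem x : m x x = x.
Proof.
by have [_ [_ [_ [_ [mj jm]]]]] := C_lattice; rewrite -{2}(jm x x) mj.
Qed.

Lemma lattice_join_le x t : m t x = x -> j t x = t.
Proof. by have [_ [_ [_ [_ [_ jm]]]]] := C_lattice; move=> <-; exact: jm. Qed.

(* The order is reversed: [m x y = y] says that [y] is below [x] in [C]. *)
Definition dual_pre : prelattice.
Proof.
apply: (@PreLattice C (fun x y => m x y = y) j m);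
  have [mA [jA [mC [jC [mj jm]]]]] := C_lattice.
- exact: lattice_idem.
- by move=> y x t xy yt; rewrite -yt mA xy.
- by move=> x y; rewrite mC mj.
- by move=> x y; rewrite mC jC mj.
- move=> x y t /lattice_join_le tx /lattice_join_le ty.
  have e : j t (j x y) = t by rewrite jA tx ty.
  by rewrite mC -[in LHS]e [j t _]jC mj.
- by move=> x y; rewrite mA lattice_idem.
- by move=> x y; rewrite [m x y]mC mA lattice_idem.
- by move=> x y t xt yt; rewrite -mA yt xt.
Defined.

End Dual.

Lemma eqop_lattice T : is_lattice (@eqop_meet T) (@eqop_join T).
Proof.
have ext (R S : EqRel T) : @le (eq_pre T) R S -> @le (eq_pre T) S R -> R = S.
  exact: eq_le_antisym.
rewrite /eqop_meet /eqop_join; split; [|split; [|split; [|split; [|split]]]].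
- move=> x y t; apply: ext; repeat (apply: (@join_lub (eq_pre T))).
  + exact: (@le_trans (eq_pre T)) (@join_l (eq_pre T) _ _) (@join_l (eq_pre T) _ _).
  + exact: (@le_trans (eq_pre T)) (@join_r (eq_pre T) _ _) (@join_l (eq_pre T) _ _).
  + exact: (@join_r (eq_pre T)).
  + exact: (@join_l (eq_pre T)).
  + exact: (@le_trans (eq_pre T)) (@join_l (eq_pre T) _ _) (@join_r (eq_pre T) _ _).
  + exact: (@le_trans (eq_pre T)) (@join_r (eq_pre T) _ _) (@join_r (eq_pre T) _ _).
- by move=> x y t; apply: ext => u v /=; rewrite /eq_meet_rel; tauto.
- by move=> x y; apply: ext; apply: (@join_lub (eq_pre T));
    (exact: (@join_l (eq_pre T)) || exact: (@join_r (eq_pre T))).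
- by move=> x y; apply: ext => u v /=; rewrite /eq_meet_rel; tauto.
- move=> x y; apply: ext; last exact: (@join_l (eq_pre T)).
  by apply: (@join_lub (eq_pre T)) => //; exact: (@meet_l (eq_pre T)).
- move=> x y; apply: ext; first exact: (@meet_l (eq_pre T)).
  by apply: (@meet_glb (eq_pre T)) => //; exact: (@join_l (eq_pre T)).
Qed.

Section Generation.
Variables (C : Type) (m j : C -> C -> C) (S : C -> Prop).
Hypothesis C_lattice : is_lattice m j.
Hypothesis S_m : forall x y, S x -> S y -> S (m x y).
Hypothesis S_j : forall x y, S x -> S y -> S (j x y).

Definition sub_op (o : C -> C -> C) (oS : forall x y, S x -> S y -> S (o x y))
  (x y : {c | S c}) : {c | S c} := exist _ _ (oS _ _ (proj2_sig x) (proj2_sig y)).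

Lemma sub_lattice : is_lattice (sub_op S_m) (sub_op S_j).
Proof.
have [mA [jA [mC [jC [mj jm]]]]] := C_lattice.
by split; [|split; [|split; [|split; [|split]]]] => -[x ?] [y ?] => [[t ?]|[t ?]||||];
  apply: eq_exist => /=.
Qed.

End Generation.

Section Embedding.
Variables (T C : Type) (m j : C -> C -> C) (i1 i2 : EqRel T -> C).
Hypothesis C_lattice : is_lattice m j.
Hypothesis i1_hom : lat_hom (@eqop_meet T) (@eqop_join T) m j i1.
Hypothesis i2_hom : lat_hom (@eqop_meet T) (@eqop_join T) m j i2.
Notation CD := (dual_pre C_lattice).

Definition copair (i : bool) : eq_bpre T -> CD := if i then i1 else i2.

Lemma copair_hom i a b : copair i (eq_join a b) = m (copair i a) (copair i b) /\
  copair i (eq_meet a b) = j (copair i a) (copair i b).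
Proof. by case: i; [exact: i1_hom|exact: i2_hom]. Qed.

Lemma copair_mono i (a b : eq_bpre T) : le a b -> le (copair i a) (copair i b).
Proof.
move=> ab; rewrite /= -(copair_hom i a b).1; congr copair.
apply: eq_le_antisym; last exact: (@join_r (eq_pre T)).
exact: (@join_lub (eq_pre T)).
Qed.

Definition generated (c : C) : Prop := exists p, c = @eval (eq_bpre T) CD copair p.

Lemma generated_m x y : generated x -> generated y -> generated (m x y).
Proof. by move=> [p ->] [q ->]; exists (Join p q). Qed.

Lemma generated_j x y : generated x -> generated y -> generated (j x y).
Proof. by move=> [p ->] [q ->]; exists (Meet p q). Qed.

Lemma generated_i1 a : generated (i1 a).
Proof. by exists (Leaf true a). Qed.

Lemma generated_i2 a : generated (i2 a).
Proof. by exists (Leaf false a). Qed.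

(** Duality swaps the bounds: the least element of [C] is the greatest of [CD] and goes to the full
    relation, which is [eqop_bot]. Injectivity comes from reflecting the order in both
    directions. *)
Lemma embedding_of_lift (z : Prop) (f : bool -> EqRel T -> EqRel T) (h : C -> EqRel T) :
  infinite T ->
  (z -> i1 (eq_bot T) = i2 (eq_bot T)) ->
  recovers z f ->
  lat_hom m j (@eqop_meet T) (@eqop_join T) h ->
  (forall a, h (i1 a) = f true a) -> (forall a, h (i2 a) = f false a) ->
  (forall c, generated c) ->
  zero_one_embedding m j (@eqop_meet T) (@eqop_join T) (eqop_bot T) (eqop_top T) h.
Proof.
move=> Tinf zi frep h_hom hi1 hi2 gen.
have [|i a b|i a b|i i' /zi zz||c d cd|[] a||h_le h_bot h_top] := frep CD copair h.
- exact: copair_mono.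
- by rewrite -[meet (copair i a) _](copair_hom i a b).2; exact: le_refl.
- by rewrite -[join (copair i a) _](copair_hom i a b).1; exact: le_refl.
- have -> : copair i bot = copair i' bot by case: i i' => [] [] //; exact: esym zz.
  exact: le_refl.
- by split=> c d; have [? ?] := h_hom c d.
- rewrite -cd.
  by have [-> _] := h_hom c d; exact: (@join_l (eq_pre T)).
- exact: hi1.
- exact: hi2.
- exact: gen.
have [_ [_ [mC _]]] := C_lattice.
split; [exact: h_hom|split; [|split]].
- move=> x y xy; have xy1 : m x y = y by apply: h_le; rewrite xy.
  have xy2 : m y x = x by apply: h_le; rewrite xy.
  by rewrite -xy2 mC xy1.
- by move=> b bb; apply: h_top => c; exact: bb.
- by move=> t tt; apply: h_bot => c; rewrite /= mC; exact: tt.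
Qed.

End Embedding.

Theorem theorem6p5 (Omega : Type) (Hinf : infinite Omega) :
  (* (Eq Ω)^op ⨿^1 (Eq Ω)^op embeds into (Eq Ω)^op *)
  (forall (C : Type) (mC jC : C -> C -> C) (tC : C)
          (i1 i2 : EqRel Omega -> C),
     is_lat1_coproduct (@eqop_meet Omega) (@eqop_join Omega) (eqop_top Omega)
                       (@eqop_meet Omega) (@eqop_join Omega) (eqop_top Omega)
                       mC jC tC i1 i2 ->
     exists f : C -> EqRel Omega,
       zero_one_embedding mC jC (@eqop_meet Omega) (@eqop_join Omega)
                          (eqop_bot Omega) (eqop_top Omega) f) /\
  (* (Eq Ω)^op ⨿ (Eq Ω)^op embeds into (Eq Ω)^op *)
  (forall (C : Type) (mC jC : C -> C -> C)
          (i1 i2 : EqRel Omega -> C),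
     is_lat_coproduct (@eqop_meet Omega) (@eqop_join Omega)
                      (@eqop_meet Omega) (@eqop_join Omega)
                      mC jC i1 i2 ->
     exists f : C -> EqRel Omega,
       zero_one_embedding mC jC (@eqop_meet Omega) (@eqop_join Omega)
                          (eqop_bot Omega) (eqop_top Omega) f).
Proof.
have f_hom (f : bool -> EqRel Omega -> EqRel Omega) i :
    @lattice_map _ (eq_pre Omega) (f i) ->
    lat_hom (@eqop_meet Omega) (@eqop_join Omega) (@eqop_meet Omega) (@eqop_join Omega) (f i).
  by move=> [fm fj] a b; split; [exact: fj|exact: fm].
split.
- move=> C mC jC tC i1 i2 [CL [topC [i1h [i1t [i2h [i2t univ]]]]]].
  (* The units of the dual lattices are the identity relations, so a common unit means that the two
     bottoms are identified. *)
  have [f [fh [fbot frep]]] := coproduct_representation Hinf True.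
  have [h [hh [_ [hi1 [hi2 _]]]]] := univ _ _ _ _ (eqop_lattice Omega)
    (fun x => @eq_le_antisym Omega _ _
       (@join_lub (eq_pre Omega) _ _ _ (@le_refl (eq_pre Omega) x) (@bot_le (eq_bpre Omega) x))
       (@join_l (eq_pre Omega) _ _))
    (f true) (f false) (f_hom f true (fh true)) (fbot I true)
    (f_hom f false (fh false)) (fbot I false).
  exists h; apply: (embedding_of_lift i1h i2h Hinf _ frep hh hi1 hi2).
    by move=> _; rewrite [LHS]i1t [RHS]i2t.
  (* The coproduct is generated by its two copies: its map to the sublattice they generate, followed
     by the inclusion, is the identity by uniqueness. *)
  pose G := generated i1 i2 CL.
  have Gt : G tC by rewrite -i1t; exact: generated_i1.
  have [] := univ _ _ _ (exist G tC Gt)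
     (sub_lattice CL (@generated_m _ _ _ _ i1 i2 CL) (@generated_j _ _ _ _ i1 i2 CL)) _
     (fun a => exist G _ (generated_i1 i1 i2 CL a)) (fun a => exist G _ (generated_i2 i1 i2 CL a)).
  + by move=> [x Gx]; apply: eq_exist; exact: topC.
  + by move=> a b; have [e1 e2] := i1h a b; split; apply: eq_exist.
  + exact: eq_exist.
  + by move=> a b; have [e1 e2] := i2h a b; split; apply: eq_exist.
  + exact: eq_exist.
  move=> k [kh [kt [k1 [k2 _]]]] c.
  have [u [_ [_ [_ [_ uniq]]]]] := univ _ _ _ _ CL topC i1 i2 i1h i1t i2h i2t.
  have -> : c = proj1_sig (k c); last exact: (proj2_sig (k c)).
  have cu : c = u c by apply: (uniq id).
  rewrite [LHS]cu; apply/esym; apply: (uniq (fun c => proj1_sig (k c))).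
  + by move=> x y; have [-> ->] := kh x y.
  + by rewrite kt.
  + by move=> a; rewrite k1.
  + by move=> a; rewrite k2.
- move=> C mC jC i1 i2 [CL [i1h [i2h univ]]].
  (* In the free product of lattices the bottoms of the two copies stay apart. *)
  have [f [fh [fbot frep]]] := coproduct_representation Hinf False.
  have [h [hh [hi1 [hi2 _]]]] := univ _ _ _ (eqop_lattice Omega)
    (f true) (f false) (f_hom f true (fh true)) (f_hom f false (fh false)).
  exists h; apply: (embedding_of_lift i1h i2h Hinf _ frep hh hi1 hi2) => // c.
  pose G := generated i1 i2 CL.
  have [] := univ _ _ _
     (sub_lattice CL (@generated_m _ _ _ _ i1 i2 CL) (@generated_j _ _ _ _ i1 i2 CL))
     (fun a => exist G _ (generated_i1 i1 i2 CL a)) (fun a => exist G _ (generated_i2 i1 i2 CL a)).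
  + by move=> a b; have [e1 e2] := i1h a b; split; apply: eq_exist.
  + by move=> a b; have [e1 e2] := i2h a b; split; apply: eq_exist.
  move=> k [kh [k1 [k2 _]]].
  have [u [_ [_ [_ uniq]]]] := univ _ _ _ CL i1 i2 i1h i2h.
  have -> : c = proj1_sig (k c); last exact: (proj2_sig (k c)).
  have cu : c = u c by apply: (uniq id).
  rewrite [LHS]cu; apply/esym; apply: (uniq (fun c => proj1_sig (k c))).
  + by move=> x y; have [-> ->] := kh x y.
  + by move=> a; rewrite k1.
  + by move=> a; rewrite k2.
Qed.
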